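(* Let $(T,\mathcal T,\lambda)$ be a complete, atomless probability space, $\mathcal F\subseteq\mathcal T$ a sub-$\sigma$-algebra, and $A$ a nonempty compact metric space. Assume that $\mathcal T$ is nowhere equivalent to $\mathcal F$. Then for any $\mathcal F$-measurable game function $v:T\to\mathcal V_{(A,T)}$ there exists a $\mathcal T$-measurable $f:T\to A$ such that for $\lambda$-a.e. $t\in T$, $$v_t\big(f(t),\lambda(\mathrm{id}_T,f)^{-1}\big)\ \ge\ v_t\big(a,\lambda(\mathrm{id}_T,f)^{-1}\big)\quad\text{for all }a\in A.$$
   Context: Nowhere equivalence: for $D\in\mathcal T$ put $\mathcal F^{D}:=\{D\cap E:\ E\in\mathcal F\}$. $\mathcal T$ is nowhere equivalent to $\mathcal F$ if for every $D\in\mathcal T$ with $\lambda(D)>0$ there exists a $\mathcal T$-measurable $D_0\subseteq D$ such that $\lambda(D_0\triangle D_1)>0$ for all $D_1\in\mathcal F^{D}$. Here the trait space is the agent space with the $\sigma$-algebra $\mathcal F$. Let $\mathcal M(T\times A)$ be the set of probability measures on $(T\times A,\mathcal F\otimes\mathcal B(A))$, where $\mathcal B(A)$ is the Borel $\sigma$-algebra of $A$. A Carathéodory function on $T\times A$ is $\varphi:T\times A\to\mathbb R$ such that $\varphi(\cdot,a)$ is $\mathcal F$-measurable for each $a\in A$ and $\varphi(t,\cdot)$ is continuous for each $t\in T$. Endow $\mathcal M(T\times A)$ with the coarsest topology making $\rho\mapsto\int_{T\times A}\varphi\,d\rho$ continuous for every bounded Carathéodory function $\varphi$. Let $\mathcal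 V_{(A,T)}:=C_b(A\times\mathcal M(T\times A))$ be the space of bounded continuous real functions on $A\times\mathcal M(T\times A)$, with the sup-norm topology and its Borel $\sigma$-algebra. An $\mathcal F$-measurable game function is an $\mathcal F$-measurable map $v:T\to\mathcal V_{(A,T)}$ that is strongly $\mathcal F$-measurable, meaning that it is, $\lambda$-almost everywhere, the pointwise limit (in sup norm) of a sequence of $\mathcal F$-measurable countably-valued functions. Write $v_t:=v(t)$. $\mathrm{id}_T$ is the identity map of $T$, and $\lambda(\mathrm{id}_T,f)^{-1}\in\mathcal M(T\times A)$ denotes the pushforward of $\lambda$ under $t\mapsto(t,f(t))$. *)

(* Defs.v *)
From HB Require Import structures.
From mathcomp Require Import all_boot all_order all_algebra.
From mathcomp Require Import all_classical all_reals all_analysis.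

Set Implicit Arguments.
Unset Strict Implicit.
Unset Printing Implicit Defensive.

Import Order.TTheory GRing.Theory Num.Theory.
Import numFieldNormedType.Exports.

Local Open Scope classical_set_scope.
Local Open Scope ring_scope.

(* The library puts sigma-algebras only on pointed types, so a nonempty metric
   space is a metric space with a distinguished point. *)
#[short(type="pmetricType")]
HB.structure Definition PointedMetric (K : numDomainType) :=
  {M of Metric K M & isPointed M}.

Notation borel X := (g_sigma_algebraType (@open X)).

Section atomless_nowhere_equivalent.
Context d (T : measurableType d) (R : realType) (lambda : probability T R).

Definition atomless := forall D : set T, measurable D -> (0 < lambda D)%E ->
  exists E : set T, [/\ measurable E, E `<=` D & (0 < lambda E < lambda D)%E].

Definition trace_system (F : set_system T) (D : set T) : set_system T :=
  [set D `&` E | E in F].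

(* `+` is symmetric difference. *)
Definition nowhere_equivalent (F : set_system T) :=
  forall D : set T, measurable D -> (0 < lambda D)%E ->
  exists D0 : set T, [/\ measurable D0, D0 `<=` D &
    forall D1 : set T, trace_system F D D1 -> (0 < lambda (D0 `+` D1))%E].

End atomless_nowhere_equivalent.

Section bounded_continuous_functions.
Context (X : topologicalType) (R : realType).

Definition bounded_continuous : {pred X -> R} :=
  mem [set f : X -> R |
    continuous f /\ exists B : R, forall x, `|f x| <= B].

Record Cb := MkCb { Cb_fun :> X -> R ; Cb_prop : Cb_fun \in bounded_continuous }.

HB.instance Definition _ := [isSub for Cb_fun].
HB.instance Definition _ := [Choice of Cb by <:].

Lemma bounded_continuous_submod : submod_closed bounded_continuous.
Proof.
split=> [|a f g].
  rewrite inE; split; first by move=> x; exact: cvg_cst.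
  by exists 0 => x; rewrite normr0.
rewrite !inE => -[cf [B fB]] [cg [C gC]]; split.
  move=> x; apply: (@cvgD _ R^o); last exact: cg.
  by apply: (@cvgZl_tmp _ R^o); exact: cf.
exists (`|a| * B + C) => x.
by rewrite (le_trans (ler_normD _ _))// lerD// normrM ler_wpM2l.
Qed.

HB.instance Definition _ :=
  GRing.isSubmodClosed.Build R (X -> R) bounded_continuous
    bounded_continuous_submod.
HB.instance Definition _ := [SubChoice_isSubLmodule of Cb by <:].

Definition sup_norm (f : Cb) : R := sup (range (fun x => `|f x|)).

Lemma Cb_continuous (f : Cb) : continuous f.
Proof. by case: f => f /= /[!inE] -[]. Qed.

Lemma Cb_has_ubound (f : Cb) : has_ubound (range (fun x => `|f x|)).
Proof. by case: f => f /= /[!inE] -[_ [B fB]]; exists B => _ [x _ <-]. Qed.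

Lemma sup_norm_ub (f : Cb) x : `|f x| <= sup_norm f.
Proof. by apply: (ub_le_sup (Cb_has_ubound f)); exists x. Qed.

Lemma sup_norm_le (f : Cb) (B : R) :
  0 <= B -> (forall x, `|f x| <= B) -> sup_norm f <= B.
Proof.
move=> B0 fB; rewrite /sup_norm.
have [->|/set0P ne0] := eqVneq (range (fun x => `|f x|)) set0.
  by rewrite sup0.
by apply: ge_sup => // _ [x _ <-].
Qed.

Lemma sup_norm_ge0 (f : Cb) : 0 <= sup_norm f.
Proof.
rewrite /sup_norm.
have [->|/set0P [_ [x _ _]]] := eqVneq (range (fun x => `|f x|)) set0.
  by rewrite sup0.
exact: le_trans (normr_ge0 _) (sup_norm_ub f x).
Qed.

Lemma sup_normD (f g : Cb) : sup_norm (f + g) <= sup_norm f + sup_norm g.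
Proof.
apply: sup_norm_le => [|x]; first by rewrite addr_ge0 ?sup_norm_ge0.
by rewrite (le_trans (ler_normD _ _))// lerD// sup_norm_ub.
Qed.

Lemma sup_normZ (a : R) (f : Cb) : sup_norm (a *: f) = `|a| * sup_norm f.
Proof.
have le (b : R) (g : Cb) : sup_norm (b *: g) <= `|b| * sup_norm g.
  apply: sup_norm_le => [|x]; first by rewrite mulr_ge0 ?sup_norm_ge0.
  by rewrite normrM ler_wpM2l// sup_norm_ub.
apply/eqP; rewrite eq_le le/=.
have [->|a0] := eqVneq a 0; first by rewrite normr0 mul0r sup_norm_ge0.
have := le a^-1 (a *: f).
rewrite scalerA mulVf// scale1r normfV => h.
by rewrite -ler_pdivlMl ?normr_gt0.
Qed.

Lemma sup_norm0_eq0 (f : Cb) : sup_norm f = 0 -> f = 0.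
Proof.
move=> f0; apply/val_inj/funext => x /=; apply/eqP.
by rewrite -normr_le0 -f0 sup_norm_ub.
Qed.

HB.instance Definition _ := Lmodule_isNormed.Build R Cb
  sup_normD sup_normZ sup_norm0_eq0.

End bounded_continuous_functions.

Section games.
Context d (T : measurableType d) (R : realType).
Variables (F : set_system T) (A : pmetricType R).

Definition bounded_caratheodory (phi : T * A -> R) :=
  [/\ forall a : A,
        measurable_fun [set: g_sigma_algebraType F] (fun t => phi (t, a)),
      forall t : T, continuous (fun a : A => phi (t, a)) &
      exists B : R, forall x, `|phi x| <= B].

Definition product_law := probability (g_sigma_algebraType F * borel A)%type R.

(* A [probability] is a function on all sets, constrained only on measurable
   ones. Two of them agreeing on measurable sets have the same integrals, so
   they are topologically indistinguishable in [distributions], and continuous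
   real functions cannot separate them. *)
Definition distributions :=
  sup_topology (fun phi : {phi | bounded_caratheodory phi} =>
    Topological.on
      (initial_topology (fun rho : product_law => \int[rho]_x sval phi x))).

HB.instance Definition _ := Topological.on distributions.

Definition payoff_space := Cb (A * distributions)%type R.

Definition measurable_to_payoff (v : T -> payoff_space) :=
  measurable_fun [set: g_sigma_algebraType F]
    (v : g_sigma_algebraType F -> borel payoff_space).

Definition strongly_measurable (lambda : probability T R)
    (v : T -> payoff_space) :=
  exists2 s : nat -> T -> payoff_space,
    forall n, measurable_to_payoff (s n) /\ countable (range (s n)) &
    {ae lambda, forall t, s n t @[n --> \oo] --> v t}.

Definition game_function (lambda : probability T R) (v : T -> payoff_space) :=
  measurable_to_payoff v /\ strongly_measurable lambda v.

Section joint_distribution.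
Variables (lambda : probability T R) (FT : F `<=` measurable).
Variable (f : {mfun T >-> borel A}).

(* [FT] is carried only so that measurability can be inferred. *)
Definition graph & F `<=` measurable :
  T -> g_sigma_algebraType F * borel A := fun t => (t, f t).

Lemma measurable_graph : measurable_fun [set: T] (graph FT).
Proof.
apply/measurable_fun_pairP; split; last exact: measurable_funPT.
move=> _ B mB; rewrite setTI.
exact: (smallest_sub (sigma_algebra_measurable T) FT mB).
Qed.

HB.instance Definition _ :=
  isMeasurableFun.Build _ _ _ _ (graph FT) measurable_graph.

Definition joint_distribution : distributions :=
  distribution lambda (graph FT).

End joint_distribution.

End games.

(* Main.v *)
Require Import Defs.
From HB Require Import structures.
From mathcomp Require Import all_boot all_order all_algebra.
From mathcomp Require Import all_classical all_reals all_analysis.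
From mathcomp Require Import measurable_realfun.
From mathcomp Require Import lra zify.

Set Implicit Arguments.
Unset Strict Implicit.
Unset Printing Implicit Defensive.

(** Every strategy is taken of the form [pi \o k], where [pi] is a continuous
    surjection of Cantor space onto [A] (Alexandroff-Hausdorff) and
    [k : T -> nat -> bool] is measurable coordinatewise. Such a [k] splits [T]
    into the cells of a binary tree, and by uniform continuity the joint law of
    [pi \o k] with the traits is determined by the numbers
    [lambda (E `&` cell k s)] for [E] in [F] and [s] a bit string: every
    functional [k |-> int phi (t, pi (k t))] with [phi] bounded and Caratheodory
    is a uniform limit of linear combinations of them ([tame_caratheodory]).

    Nowhere equivalence says that the agent space is atomless relative to [F].
    Hence a measure on [F] dominated by [E |-> lambda (E `&` D)] is always of the
    form [E |-> lambda (E `&` D')] with [D'] inside [D] ([carve], a conditional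
    Lyapunov theorem: halve with Hahn decompositions on [F], then exhaust).
    Carving along the binary tree realizes every consistent family of cell
    masses by a pure strategy ([realization]). So laws of pure strategies are
    closed under convex combinations ([mixture_exists]) and under limits along
    ultrafilters ([strategies_compact]).

    Given finitely many deviations, their mixtures form a simplex on which the
    payoffs are continuous, and some mixture is a best reply to itself among
    these deviations ([finite_best_reply]). This has the strength of Brouwer's
    theorem; it comes from Scarf's lemma on dominant sets ([scarf]), whose proof
    is a parity count, applied to finer and finer grids
    ([simplex_equilibrium]). The sets of strategies against which a given
    deviation does not pay thus have the finite intersection property, and an
    ultrafilter containing them all has a limit strategy. Strong measurability
    makes [v] essentially separable, so that the payoffs depend on the law
    uniformly in the strategy of the deviator ([utility_continuous]); the
    inequalities therefore pass to the limit. A strategy whose integrated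
    payoff no deviation improves is optimal almost everywhere, since otherwise
    switching to one constant action on a set of positive measure would pay
    ([no_profitable_deviation]). *)

(** * Scarf's lemma *)

Section scarf.
Local Open Scope nat_scope.
Context (V I : finType) (v0 : V) (rho : I -> V -> nat) (c : V -> I).
Hypothesis rho_inj : forall i, injective (rho i).

Let big := (\max_(i : I) \max_(v : V) rho i v).+2.

(** The set [V] is enlarged by one slack point for each coordinate, smallest for
    its own ranking and above all of [V] for the others. A dominant set that
    contains the slack of [i] behaves like a subset of [V] tested on the other
    coordinates only, so faces of the simplex need no separate treatment. *)
Definition slack_rank (i : I) (w : V + I) : nat :=
  match w with
  | inl v => (rho i v).+1
  | inr j => if j == i then 0 else big + enum_rank j
  end.

Definition slack_color (w : V + I) : I :=
  match w with inl v => c v | inr i => i end.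

(** Those with one point per ranking are Scarf's primitive sets. *)
Definition dominant (B : {set V + I}) : bool :=
  [forall w, [exists i, [forall b in B, slack_rank i w <= slack_rank i b]]].

Lemma rho_lt_big i v : (rho i v).+1 < big.
Proof.
rewrite ltnS ltnS.
apply: leq_trans (leq_bigmax i).
exact: (leq_bigmax v).
Qed.

Lemma slack_rank_inj i : injective (slack_rank i).
Proof.
move=> [v|j] [v'|j'] /=.
- by move=> [] /rho_inj ->.
- case: ifP => // _ E; have := rho_lt_big i v.
  by rewrite E ltnNge leq_addr.
- case: ifP => // _ E; have := rho_lt_big i v'.
  by rewrite -E ltnNge leq_addr.
- case: ifP => [/eqP->|ji]; case: ifP => [/eqP->|ji'] //.
  by move=> /addnI /ord_inj /enum_rank_inj ->.
Qed.

Lemma dominantP (B : {set V + I}) :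
  reflect (forall w, exists i, forall b, b \in B -> slack_rank i w <= slack_rank i b)
    (dominant B).
Proof.
apply: (iffP forallP) => H w.
  by have /existsP[i /forall_inP] := H w; exists i.
by have [i Hi] := H w; apply/existsP; exists i; apply/forall_inP.
Qed.

Lemma dominantS (B B' : {set V + I}) : B' \subset B -> dominant B -> dominant B'.
Proof.
move=> /fintype.subsetP sB /dominantP dB; apply/dominantP => w.
by have [i Hi] := dB w; exists i => b /sB; exact: Hi.
Qed.

Definition argleast (B : {set V + I}) (i : I) : V + I :=
  odflt (inl v0)
    [pick b in B | [forall b' in B, slack_rank i b <= slack_rank i b']].

Lemma argleastP (B : {set V + I}) i b0 : b0 \in B ->
  argleast B i \in B /\
  forall b, b \in B -> slack_rank i (argleast B i) <= slack_rank i b.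
Proof.
move=> b0B; rewrite /argleast; case: pickP => [b /andP[bB /forall_inP bmin]//|].
have [b bB bmin] := arg_minnP (slack_rank i) b0B.
by move=> /(_ b) /negP[]; apply/andP; split=> //; apply/forall_inP.
Qed.

Lemma argleast_eq (B : {set V + I}) i b : b \in B ->
  (forall b', b' \in B -> slack_rank i b <= slack_rank i b') ->
  argleast B i = b.
Proof.
move=> bB bmin; have [aB amin] := argleastP i bB.
by apply: (@slack_rank_inj i); apply/eqP; rewrite eqn_leq amin ?bmin.
Qed.

(** Dominance applied to [b] itself produces a ranking for which [b] is least in
    [B]; in particular [B] has at most as many points as there are rankings. *)
Lemma argleast_onto (B : {set V + I}) b0 : b0 \in B -> dominant B ->
  argleast B @: [set: I] = B.
Proof.
move=> b0B /dominantP dB; apply/setP => b; apply/imsetP/idP => [[i _ ->]|bB].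
  by have [] := argleastP i b0B.
have [i Hi] := dB b; exists i; first by rewrite inE.
by rewrite (argleast_eq bB).
Qed.

Section doors.
Variables (E : {set V + I}) (e0 : V).
Hypotheses (e0E : inl e0 \in E) (dE : dominant E) (cE : #|E|.+1 = #|I|).

Let mu := argleast E.

Let muE i : mu i \in E. Proof. by have [] := argleastP i e0E. Qed.

Let mu_le i b : b \in E -> slack_rank i (mu i) <= slack_rank i b.
Proof. by have [_] := argleastP i e0E; exact. Qed.

(** The points that only the ranking [i] prevents from violating the dominance
    of [E]. *)
Definition above (i : I) : {set V + I} :=
  [set w | [forall j, (j != i) ==> (slack_rank j (mu j) < slack_rank j w)]].

Lemma aboveP i w :
  reflect (forall j, j != i -> slack_rank j (mu j) < slack_rank j w)
    (w \in above i).
Proof.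
rewrite inE; apply: (iffP forallP) => H j; first by move: (H j) => /implyP.
by apply/implyP; exact: H.
Qed.

Lemma above_slack i : inr i \in above i.
Proof.
apply/aboveP => j ji /=; rewrite eq_sym (negbTE ji).
by apply: (leq_trans (leq_ltn_trans (mu_le j e0E) (rho_lt_big j e0))); exact: leq_addr.
Qed.

Definition topmost i : V + I := [arg max_(w > inr i in above i) slack_rank i w].

Lemma topmostP i : topmost i \in above i /\
  forall w, w \in above i -> slack_rank i w <= slack_rank i (topmost i).
Proof. by rewrite /topmost; case: arg_maxnP => [|w *]; [exact: above_slack|]. Qed.

Lemma above_lower i w b : w \in above i -> b \in E ->
  slack_rank i w <= slack_rank i b.
Proof.
move=> /aboveP wi bE; have /dominantP/(_ w)[j Hj] := dE.
have [<-|ji] := eqVneq j i; first exact: Hj.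
by have := Hj _ (muE j); rewrite leqNgt wi.
Qed.

Lemma dominant_topmost i : dominant (topmost i |: E).
Proof.
have [xi xmax] := topmostP i.
apply/dominantP => w; have [wi|] := boolP (w \in above i).
  exists i => b /setU1P[->|bE]; [exact: xmax|exact: above_lower].
rewrite inE negb_forall => /existsP[j]; rewrite negb_imply -leqNgt => /andP[ji wj].
exists j => b /setU1P[->|bE]; last exact: leq_trans wj (mu_le j bE).
by apply: leq_trans wj (ltnW _); move/aboveP: xi; apply.
Qed.

(** With one point fewer than rankings, exactly two rankings [i1] and [i2] share
    their least point in [E]. A completing point must take over one of these two
    roles, and it is then the topmost point above [E] for that ranking. *)
Lemma card_completions : #|[set x | (x \notin E) && dominant (x |: E)]| = 2.
Proof.
have muT : mu @: [set: I] = E by exact: argleast_onto e0E dE.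
have [i1 [i2 [i12 mu12]]] : exists i1 i2, i1 != i2 /\ mu i1 = mu i2.
  apply: contrapT => H; have : #|E| = #|I|.
    rewrite -muT card_imset ?cardsT// => i j ij; apply/eqP/negP => /negP n.
    by apply: H; exists i, j.
  by move=> EI; move: cE; rewrite EI => /eqP; rewrite eqn_leq ltnn.
have muE' i e : i \in [:: i1; i2] -> e \in E -> exists2 k, k != i & mu k = e.
  move=> i_ eE; have /imsetP[k _ ->] : e \in mu @: [set: I] by rewrite muT.
  have [ki|ki] := eqVneq k i; last by exists k.
  subst k; move: i_; rewrite !inE => /orP[/eqP->|/eqP->].
    by exists i2 => //; rewrite eq_sym.
  by exists i1.
have nE i : i \in [:: i1; i2] -> topmost i \notin E.
  move=> i_; apply/negP => /(muE' _ _ i_)[k ki kx].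
  by have [/aboveP/(_ _ ki)] := topmostP i; rewrite kx ltnn.
have ne : topmost i1 != topmost i2.
  apply/negP => /eqP e.
  have [/aboveP/(_ _ i12) + _] := topmostP i2.
  have [/above_lower/(_ (muE i1)) + _] := topmostP i1.
  by rewrite e => /leq_ltn_trans /[apply]; rewrite ltnn.
suff -> : [set x | (x \notin E) && dominant (x |: E)] =
    [set topmost i1; topmost i2] by rewrite cards2 ne.
apply/setP => x; rewrite !inE; apply/andP/orP => [[xE dB]|].
  have xB : x \in x |: E by rewrite setU11.
  set nu := argleast (x |: E).
  have nuT : nu @: [set: I] = x |: E by exact: argleast_onto xB dB.
  have nu_inj : injective nu.
    have /imset_injP H : #|nu @: [set: I]| == #|[set: I]|.
      by rewrite nuT cardsU1 xE cardsT add1n cE.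
    by move=> i j; apply: H; rewrite inE.
  have [i _ xi] : exists2 i, i \in [set: I] & x = nu i.
    by apply/imsetP; rewrite nuT.
  have numu j : j != i -> nu j = mu j.
    move=> ji; have [nuB numin] := argleastP j xB.
    have nuE : nu j \in E.
      have nx : nu j != x by apply/eqP; rewrite xi => /nu_inj /eqP; exact/negP.
      by move: nuB; rewrite in_setU1 (negbTE nx).
    by apply/esym/argleast_eq => // b bE; apply: numin; rewrite in_setU1 bE orbT.
  have xabove : x \in above i.
    apply/aboveP => j ji; rewrite -numu// ltn_neqAle.
    have [_ -> //] := argleastP j xB; rewrite andbT.
    by apply/negP => /eqP /slack_rank_inj; rewrite xi => /nu_inj /eqP; exact/negP.
  have -> : x = topmost i.
    have [ta tmax] := topmostP i.
    apply: (@slack_rank_inj i); apply/eqP; rewrite eqn_leq tmax//=.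
    have /dominantP/(_ (topmost i))[j Hj] := dB.
    have [ji|ji] := eqVneq j i; first by rewrite -{1 3}ji Hj.
    have := Hj (mu j); rewrite in_setU1 muE orbT => /(_ isT).
    by move/aboveP: ta => /(_ _ ji); rewrite ltnNge => /negbTE ->.
  have [->|ii1] := eqVneq i i1; first by left.
  have [->|ii2] := eqVneq i i2; first by right.
  move: mu12; rewrite -!numu 1?eq_sym// => /nu_inj /eqP.
  by rewrite (negbTE i12).
by case=> /eqP ->; rewrite dominant_topmost nE// !inE eqxx ?orbT.
Qed.
End doors.

Variable i0 : I.

(** In the parity argument the dominant sets with one point per ranking are the
    rooms. A door carries every colour except [i0], once each; a room with all
    colours has one door, any other room has zero or two. *)
Definition door (E : {set V + I}) : bool :=
  (#|E|.+1 == #|I|) && (slack_color @: E == [set~ i0]).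

(** The door made of slack points only is the entrance: it leads into a single
    room, because only the ranking [i0] can be completed. *)
Lemma card_completions_slack :
  #|[set x | (x \notin (@inr V I @: [set~ i0])) &&
     dominant (x |: (@inr V I @: [set~ i0]))]| = 1.
Proof.
set E := inr @: _.
have inE' j : (inr j \in E) = (j != i0).
  by rewrite mem_imset ?inE// => ? ? [].
have nE v : inl v \notin E by apply/imsetP => -[].
have [vm _ vmax] := @arg_maxnP V v0 predT (rho i0) isT.
have {}vmax v : rho i0 v <= rho i0 vm by exact: vmax.
apply/eqP/cards1P; exists (inl vm); apply/setP => x; rewrite !inE.
apply/andP/eqP => [[xE /dominantP dB]|->].
  have [i Hi] := dB (inl vm).
  have ii0 : i = i0.
    apply/eqP/negP => /negP ii0.
    by have := Hi (inr i); rewrite in_setU1 inE' ii0 orbT /= eqxx => /(_ isT).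
  have := Hi x (setU11 _ _); rewrite ii0.
  case: x xE {dB Hi} => [v _|j]; last first.
    by rewrite inE' negbK => /eqP -> /=; rewrite eqxx.
  move=> /= vv; have [rv|] := leqP (rho i0 v) (rho i0 vm); last first.
    by rewrite ltnNge (vmax v).
  by congr inl; apply: (@rho_inj i0); apply/eqP; rewrite eqn_leq rv.
split; first exact: nE.
apply/dominantP => -[v|j]; last by exists j => b _ /=; rewrite eqxx.
exists i0 => b /setU1P[->|]; first by rewrite /= ltnS vmax.
move=> /imsetP[j]; rewrite !inE => ji0 -> /=; rewrite (negbTE ji0).
exact: leq_trans (ltnW (rho_lt_big i0 v)) (leq_addr _ _).
Qed.

Lemma even_completions E : door E -> E != inr @: [set~ i0] ->
  2 %| #|[set x | (x \notin E) && dominant (x |: E)]|.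
Proof.
move=> /andP[/eqP cE /eqP colE] Eslack.
have [/existsP[v vE]|] := boolP [exists v, inl v \in E].
  have [dE|ndE] := boolP (dominant E); first by rewrite (card_completions vE).
  rewrite (_ : finset _ = finset.set0) ?cards0//.
  apply/setP => x; rewrite !inE; apply/negP => /andP[_].
  by apply/negP/(contraNN _ ndE); apply: dominantS; exact: finset.subsetUr.
rewrite negb_exists => /forallP nV; case/negP: Eslack; apply/eqP.
have Eslack x : x \in E -> x = inr (slack_color x).
  by case: x => [v vE|//]; move: (nV v); rewrite vE.
apply/setP => x; apply/idP/imsetP => [xE|[i]].
  exists (slack_color x); last exact: Eslack.
  by rewrite -colE imset_f.
by rewrite -colE => /imsetP[y yE ->] ->; rewrite -Eslack.
Qed.

(** Dropping [x] leaves a door although some colour is missing from [B], so the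
    colour of [x] occurs a second time, at some [y]; then [x] and [y] are exactly
    the points that can be dropped. *)
Lemma even_doors (B : {set V + I}) : slack_color @: B != [set: I] ->
  2 %| #|[set x in B | door (B :\ x)]|.
Proof.
move=> nB; have [->|/set0Pn[x]] := eqVneq [set x in B | door (B :\ x)] finset.set0.
  by rewrite cards0.
have door_inj z : z \in B -> door (B :\ z) -> {in B :\ z &, injective slack_color}.
  move=> zB /andP[/eqP cz /eqP colz]; apply/imset_injP.
  by rewrite colz cardsC1 -cz.
rewrite inE => /andP[xB dx]; have /andP[/eqP cx /eqP colx] := dx.
have colx0 : slack_color x != i0.
  apply/negP => /eqP x0; case/negP: nB; apply/eqP/setP => i; rewrite !inE.
  have [->|ii0] := eqVneq i i0; first by rewrite -x0 imset_f.
  have : i \in slack_color @: (B :\ x) by rewrite colx !inE.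
  by apply/fintype.subsetP/imsetS; exact: finset.subsetDl.
have : slack_color x \in slack_color @: (B :\ x) by rewrite colx !inE.
case/imsetP => y; rewrite !inE => /andP[yx yB] xy.
rewrite (_ : finset _ = [set x; y]) ?cards2 ?(eq_sym x) ?yx//.
apply/setP => z; rewrite !inE; apply/andP/orP => [[zB dz]|[/eqP->//|/eqP->]].
  apply: contrapT => /not_orP[/negP zx /negP zy].
  case/negP: yx; apply/eqP; apply: (door_inj z) => //;
    by rewrite !inE eq_sym ?zx ?zy.
split=> //; apply/andP; split.
  by rewrite -cx; move: (cardsD1 x B) (cardsD1 y B); rewrite xB yB !add1n => -> ->.
rewrite -colx; apply/eqP/setP => i; apply/imsetP/imsetP => -[w];
    rewrite !inE => /andP[wn wB] ->.
  have [->|wx] := eqVneq w x; first by exists y; rewrite ?inE ?yx.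
  by exists w => //; rewrite !inE wx.
have [->|wy] := eqVneq w y; first by exists x; rewrite ?inE ?xy// eq_sym yx.
by exists w => //; rewrite !inE wy.
Qed.

(** Both counts of the pairs formed by a door and a room behind it are compared:
    seen from the doors the total is odd because of the entrance, while without
    a room of all colours it would be even seen from the rooms. *)
Theorem scarf : exists B : {set V + I}, dominant B /\ slack_color @: B = [set: I].
Proof.
apply: contrapT => H.
pose P := \sum_(x : V + I)
  \sum_(E : {set V + I} | (x \notin E) && door E && dominant (x |: E)) 1.
have even : 2 %| P.
  have -> : P = \sum_(B : {set V + I} | dominant B) #|[set x in B | door (B :\ x)]|.
    transitivity (\sum_(x : V + I)
        \sum_(B : {set V + I} | (x \in B) && door (B :\ x) && dominant B) 1).
      apply: eq_bigr => x _.
      rewrite (reindex_onto (fun B => B :\ x) (fun E => x |: E)); last first.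
        by move=> E /andP[/andP[xE _] _]; rewrite finset.setU1K.
      apply: eq_bigl => B; rewrite !inE eqxx /=.
      have [xB|xB] := boolP (x \in B); first by rewrite finset.setD1K ?eqxx ?andbT.
      rewrite (_ : _ == _ = false) ?andbF//; apply/eqP => BB.
      by move: xB; rewrite -BB setU11.
    rewrite (exchange_big_dep dominant) /=; last by move=> x B _ /andP[].
    apply: eq_bigr => B dB; rewrite -sum1_card; apply: eq_bigl => x.
    by rewrite !inE dB andbT.
  apply: dvdn_sum => B dB; apply: even_doors; apply/eqP => colB.
  by apply: H; exists B.
have : P = \sum_(E : {set V + I} | door E)
    #|[set x | (x \notin E) && dominant (x |: E)]|.
  rewrite /P (exchange_big_dep door) /=; last by move=> x E _ /andP[/andP[]].
  apply: eq_bigr => E dE; rewrite -sum1_card; apply: eq_bigl => x.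
  by rewrite !inE dE andbT.
have d0 : door (inr @: [set~ i0]).
  have cI : #|[set~ i0]|.+1 = #|I|.
    by rewrite cardsC1 prednK//; apply/card_gt0P; exists i0.
  apply/andP; split; first by rewrite card_imset ?cI// => ? ? [].
  apply/eqP/setP => i; rewrite -imset_comp; apply/imsetP/idP => [[j j0 ->]//|ii].
  by exists i.
rewrite (bigD1 (inr @: [set~ i0]))//= card_completions_slack => PE.
move: even; rewrite PE dvdn_addl//; apply: dvdn_sum => E /andP[dE Es].
exact: even_completions.
Qed.

End scarf.

Import Order.TTheory GRing.Theory Num.Theory.
Import numFieldNormedType.Exports.

Local Open Scope classical_set_scope.
Local Open Scope ring_scope.

(** * Equilibria on a simplex *)

Section grid.
Local Open Scope nat_scope.
Variables (n N : nat) (c : {ffun 'I_n.+1 -> nat} -> 'I_n.+1).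

Let I := 'I_n.+1.
Let V := {v : {ffun I -> 'I_N.+1} | \sum_i (v i : nat) == N}.

Definition grid_point (v : V) : {ffun I -> nat} := [ffun i => val v i : nat].

(** Comparison of the [i]-th coordinates, with ties broken by an enumeration of
    the grid to make the ranking injective. *)
Definition grid_rank (i : I) (v : V) : nat :=
  grid_point v i * #|{: V}| + enum_rank v.

Lemma grid_rank_inj i : injective (grid_rank i).
Proof.
move=> v w /(congr1 (modn^~ #|{: V}|)).
rewrite !modnMDl !modn_small ?ltn_ord// => /ord_inj; exact: enum_rank_inj.
Qed.

Lemma grid_rank_le i v w : grid_rank i v <= grid_rank i w ->
  grid_point v i <= grid_point w i.
Proof.
rewrite leqNgt => /negP H; rewrite leqNgt; apply/negP => wv; apply: H.
rewrite /grid_rank; apply: (@leq_trans (grid_point w i * #|{: V}| + #|{: V}|)).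
  by rewrite ltn_add2l ltn_ord.
by rewrite -mulSnr (leq_trans _ (leq_addr _ _))// leq_mul2r wv orbT.
Qed.

Lemma grid_exists (f : I -> nat) : \sum_i f i = N -> exists v : V, grid_point v =1 f.
Proof.
move=> fN; have fle i : f i < N.+1 by rewrite ltnS -fN (bigD1 i)//= leq_addr.
pose g : {ffun I -> 'I_N.+1} := [ffun i => Ordinal (fle i)].
have gN : \sum_i (g i : nat) == N.
  by apply/eqP; rewrite -[RHS]fN; apply: eq_bigr => i _; rewrite ffunE.
by exists (exist _ g gN) => i; rewrite !ffunE.
Qed.

Lemma grid_point_sum (v : V) : \sum_i grid_point v i = N.
Proof.
by case: v => v vN /=; rewrite -[RHS](eqP vN); apply: eq_bigr => i _; rewrite ffunE.
Qed.

(** If the points of a dominant set were far apart, the coordinatewise minimum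
    [m] over the set would sum to much less than [N], and raising each [m j] by
    one, then spending the rest arbitrarily, would give a grid point that
    violates dominance. So all points of the set agree up to [n.+1] steps. The
    coordinates outside [C] are those whose slack point belongs to the set, and
    there the points nearly vanish. *)
Lemma sperner_grid : exists (C : {set I}) (s : I -> {ffun I -> nat}),
  [/\ C != finset.set0,
      forall i, i \in C -> c (s i) = i /\ \sum_j s i j = N,
      forall i j, i \in C -> j \notin C -> s i j <= n.+1 &
      forall i k j, i \in C -> k \in C -> s i j <= s k j + n.+1].
Proof.
have [v0 _] : exists v0 : V, grid_point v0 =1 (fun i => (i == ord0) * N).
  apply: grid_exists; rewrite (bigD1 ord0)//= mul1n big1 ?addn0// => i /negbTE ->.
  by rewrite mul0n.
have [B [/dominantP dB colB]] := scarf v0 (c \o grid_point) grid_rank_inj (ord0 : I).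
pose C := [set i : I | inr i \notin B]%SET.
have CB i : i \in C -> exists2 v, inl v \in B & c (grid_point v) = i.
  rewrite inE => iB; have := finset.in_setT i.
  rewrite -colB => /imsetP[[v|j] vB /= ij]; first by exists v.
  by move/negP: iB; rewrite ij.
have dC v : exists2 i, i \in C &
    forall w, inl w \in B -> grid_point v i <= grid_point w i.
  have [i Hi] := dB (inl v); exists i.
    by rewrite inE; apply/negP => /Hi /=; rewrite eqxx.
  by move=> w /Hi /=; rewrite ltnS => /grid_rank_le.
have C0 : C != finset.set0 by have [i iC _] := dC v0; apply/set0Pn; exists i.
have [s Hs] : exists s : I -> V, forall i, i \in C ->
    inl (s i) \in B /\ c (grid_point (s i)) = i.
  suff /choice[s Hs] : forall i, exists v, i \in C -> inl v \in B /\ c (grid_point v) = i.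
    by exists s.
  move=> i; have [iC|iC] := boolP (i \in C); last by exists v0.
  by have [v vB cv] := CB _ iC; exists v.
have [k0 k0C] := set0Pn _ C0.
pose m j := grid_point (s [arg min_(k < k0 in C) grid_point (s k) j]) j.
have m_le j k : k \in C -> m j <= grid_point (s k) j.
  by rewrite /m; case: arg_minnP => // i _; exact.
have m_attained j : exists2 k, k \in C & m j = grid_point (s k) j.
  by rewrite /m; case: arg_minnP => // i iC _; exists i.
have big_m : N < \sum_(j in C) (m j).+1.
  rewrite ltnNge; apply/negP => le.
  (* the excess of [N] over the raised minimum goes to the coordinate [k0] *)
  pose f j := (j \in C) * (m j).+1 + (j == k0) * (N - \sum_(j in C) (m j).+1).
  have fN : \sum_j f j = N.
    rewrite /f big_split /=.
    have -> : \sum_j (j \in C) * (m j).+1 = \sum_(j in C) (m j).+1.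
      rewrite [RHS]big_mkcond; apply: eq_bigr => j _.
      by case: ifP; rewrite ?mul1n ?mul0n.
    rewrite [X in _ + X](bigD1 k0)//= eqxx mul1n.
    rewrite [X in _ + (_ + X)]big1 ?addn0 ?subnKC// => j /negbTE ->.
    by rewrite mul0n.
  have [v vf] := grid_exists fN.
  have [i iC vi] := dC v; have [k kC mk] := m_attained i.
  have := vi (s k) (Hs _ kC).1; rewrite vf -mk /f iC mul1n addSn.
  by rewrite ltnNge leq_addr.
have excess k : k \in C ->
    \sum_(j in C) (grid_point (s k) j - m j) +
    \sum_(j | j \notin C) grid_point (s k) j < n.+2.
  move=> kC.
  have sN : \sum_(j in C) grid_point (s k) j +
      \sum_(j | j \notin C) grid_point (s k) j = N.
    by rewrite -[RHS](grid_point_sum (s k)) [RHS](bigID (mem C)).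
  have : \sum_(j in C) grid_point (s k) j =
         \sum_(j in C) (grid_point (s k) j - m j) + \sum_(j in C) m j.
    by rewrite -big_split /=; apply: eq_bigr => j jC; rewrite subnK ?m_le.
  have : \sum_(j in C) (m j).+1 = \sum_(j in C) m j + #|C|.
    by rewrite -sum1_card -big_split /=; apply: eq_bigr => j _; rewrite addn1.
  have : #|C| <= n.+1 by rewrite (leq_trans (max_card _))// card_ord.
  move=> H1 H2 H3; move: sN big_m; rewrite H2 H3.
  move: (\sum_(j | _) _) (\sum_(j in C) m j) (\sum_(j in C) _) H1 => a b e.
  by lia.
exists C, (grid_point \o s); split=> //.
- by move=> i iC; split; [exact: (Hs _ iC).2|exact: grid_point_sum].
- move=> i j iC jC; have := excess _ iC.
  by rewrite [X in _ + X](bigD1 j)//=; lia.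
- move=> i k j iC kC /=; have [jC|jC] := boolP (j \in C).
    have := m_le j k kC; have := m_le j i iC; have := excess _ iC.
    by rewrite [X in X + _](bigD1 j)//=; lia.
  by have := excess _ iC; rewrite [X in _ + X](bigD1 j)//=; lia.
Qed.

End grid.

Lemma ultra_cvg_compact (J : Type) (U : set_system J) (X : topologicalType)
    (K : set X) (g : J -> X) : UltraFilter U -> compact K ->
  (forall j, K (g j)) -> exists2 l, K l & g @ U --> l.
Proof.
move=> UU cK Kg; 
have UK : (g @ U) K.
  by change (U (g @^-1` K)); rewrite (_ : g @^-1` K = setT);
    [exact: filterT|apply/seteqP; split=> // j _; exact: Kg].
have [l [Kl cl]] := cK (g @ U) _ UK.
exists l => // V lV.
have [//|UV] := in_ultra_setVsetC (g @^-1` V) UU.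
by have [x [/= nVx Vx]] := cl (~` V) V UV lV.
Qed.

Lemma ultra_cvg_itv (R : realType) (J : Type) (U : set_system J) (g : J -> R)
    (a b : R) : UltraFilter U ->
  (forall j, a <= g j <= b) -> exists2 l, a <= l <= b & g @ U --> l.
Proof.
move=> UU gab.
have gK j : [set` `[a, b]] (g j) by rewrite /= in_itv/= gab.
have [l] := ultra_cvg_compact UU (@segment_compact R a b) gK.
by rewrite /= in_itv/=; exists l.
Qed.

Lemma cvgr_sum (R : realType) (J : Type) (U : set_system J) (K : Type)
    (r : seq K) (g : K -> J -> R) (l : K -> R) : Filter U ->
  (forall k, g k @ U --> l k) ->
  (fun j => \sum_(k <- r) g k j) @ U --> \sum_(k <- r) l k.
Proof.
move=> FU gl; elim: r => [|k r IHr].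
  by under eq_fun do rewrite big_nil; rewrite big_nil; exact: cvg_cst.
under eq_fun do rewrite big_cons; rewrite big_cons.
by apply: cvgD; [exact: gl|exact: IHr].
Qed.

Section simplex.
Context (R : realType) (n : nat).
Let I := 'I_n.+1.

Definition simplex (p : I -> R) := (forall i, 0 <= p i) /\ \sum_i p i = 1.

Definition simplex_continuous (u : (I -> R) -> R) := forall p, simplex p ->
  forall e, 0 < e -> exists2 d, 0 < d & forall q, simplex q ->
    (forall i, `|q i - p i| < d) -> `|u q - u p| <= e.

(** Grid points are coloured by a coordinate of largest payoff. As the mesh tends
    to zero along an ultrafilter, the sets with all colours of [C] shrink to a
    point [p]: a colour that belongs to [C] for almost all meshes, in the sense
    of the ultrafilter, is optimal at [p] by continuity, and every other
    coordinate of [p] vanishes. So all the weight of [p] lies on optimal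
    coordinates. *)
Theorem simplex_equilibrium (u : I -> (I -> R) -> R) :
  (forall i, simplex_continuous (u i)) ->
  exists2 p, simplex p & forall i, u i p <= \sum_j p j * u j p.
Proof.
move=> u_cont.
pose sc (N : nat) (s : {ffun I -> nat}) (i : I) : R := (s i)%:R / N.+1%:R.
pose label N s : I := [arg max_(i > ord0) u i (sc N s)]%O.
have labelP N s i : u i (sc N s) <= u (label N s) (sc N s).
  by rewrite /label; case: arg_maxP => // j _; exact.
have [C /choice[s Hs]] := choice (fun N => sperner_grid N.+1 (label N)).
have sc_simplex N i : i \in C N -> simplex (sc N (s N i)).
  have [_ H _ _] := Hs N => /H[_ sN]; split.
    by move=> j; rewrite /sc divr_ge0.
  by rewrite /sc -mulr_suml -natr_sum sN divff.
have /choice[k kC] : forall N, exists k, k \in C N.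
  by move=> N; have [/set0Pn] := Hs N.
pose y N := sc N (s N (k N)).
have [U [UU sU]] := ultraFilterLemma eventually_filter.
have y01 j N : 0 <= y N j <= 1.
  have [y0 y1] := sc_simplex N _ (kC N); rewrite y0/= -y1 (bigD1 j)//= lerDl.
  exact: sumr_ge0.
have /choice[p pP] : forall j, exists l : R, (y^~ j) @ U --> l.
  by move=> j; have [l _ yl] := ultra_cvg_itv UU (y01 j); exists l.
have p_simplex : simplex p.
  split=> [j|].
    apply: (cvgr_to_ge (pP j)); near=> N.
    by have /andP[] := y01 j N.
  have sp : (fun N => \sum_j y N j) @ U --> \sum_j p j.
    by apply: cvgr_sum => j; exact: pP.
  apply: (cvg_unique _ sp) => //.
  rewrite (_ : (fun _ => _) = cst 1); first exact: cvg_cst.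
  by apply/funext => N; have [] := sc_simplex N _ (kC N).
have mesh (d : R) : 0 < d -> \forall N \near U, n.+1%:R / N.+1%:R < d.
  move=> d0; apply: sU.
  near=> N; rewrite ltr_pdivrMr// mulrC -ltr_pdivrMr// -[N.+1%:R]natr1.
  rewrite ltr_wpDr//; near: N; exact: nbhs_infty_gtr.
have max_or0 i : (forall j, u j p <= u i p) \/ p i = 0.
  have [UC|UC] := in_ultra_setVsetC [set N | i \in C N] UU; [left=> j|right].
    apply/ler_addgt0Pr => e e0; have e2 : 0 < e / 2 by rewrite divr_gt0.
    have [d d0 uid] := u_cont i p p_simplex _ e2.
    have [d' d'0 ujd] := u_cont j p p_simplex _ e2.
    (* half for the distance to [p] along [U], half for the mesh *)
    pose dd := Num.min d d' / 2.
    have dd0 : 0 < dd by rewrite divr_gt0// lt_min d0.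
    have yp : \forall N \near U, forall m, `|y N m - p m| < dd.
      apply: filter_forall => m; have /cvgrPdist_lt/(_ _ dd0) := pP m.
      by apply: filterS => N; rewrite distrC.
    have [N [[iC ypN] meshN]] := filter_ex (filterI (filterI UC yp) (mesh _ dd0)).
    have close m : `|sc N (s N i) m - p m| < 2 * dd.
      have [_ _ _ /(_ i (k N) m iC (kC N)) le1] := Hs N.
      have [_ _ _ /(_ (k N) i m (kC N) iC) le2] := Hs N.
      have := ypN m; rewrite !ltr_norml => /andP[].
      have : sc N (s N i) m <= y N m + n.+1%:R / N.+1%:R.
        by rewrite /y /sc -mulrDl ler_pM2r ?invr_gt0// -natrD ler_nat.
      have : y N m <= sc N (s N i) m + n.+1%:R / N.+1%:R.
        by rewrite /y /sc -mulrDl ler_pM2r ?invr_gt0// -natrD ler_nat.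
      move: meshN; move: (n.+1%:R / _) => h *; apply/andP; split; lra.
    have d2 : 2 * dd <= d /\ 2 * dd <= d'.
      by rewrite /dd mulrC divfK// !ge_min !lexx orbT.
    have := uid _ (sc_simplex N i iC) (fun m => lt_le_trans (close m) d2.1).
    have := ujd _ (sc_simplex N i iC) (fun m => lt_le_trans (close m) d2.2).
    have [_ /(_ i iC)[lab _] _ _] := Hs N.
    have := labelP N (s N i) j; rewrite lab !ler_norml => + /andP[? ?] /andP[? ?]; lra.
  apply/eqP; rewrite eq_le p_simplex.1 andbT; apply/ler_addgt0Pr => e e0.
  rewrite add0r; apply: (cvgr_to_le (pP i)).
  near=> N; apply: (@le_trans _ _ (n.+1%:R / N.+1%:R)).
    rewrite /y /sc ler_pM2r ?invr_gt0// ler_nat.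
    have [_ _ H _] := Hs N; apply: H => //; apply/negP; near: N.
    exact: UC.
  by apply: ltW; near: N; exact: mesh.
exists p => // i; rewrite -[u i p]mul1r -p_simplex.2 mulr_suml.
apply: ler_sum => j _; have [uj|->] := max_or0 j; last by rewrite !mul0r.
exact: ler_wpM2l (p_simplex.1 j) _ _ (uj i).
Unshelve. all: by end_near. Qed.

End simplex.

(** * Atomlessness relative to a sub-sigma-algebra *)

Section mass.
Context d (T : measurableType d) (R : realType) (lambda : probability T R).

Definition mass (A : set T) : R := fine (lambda A).

Lemma massE A : measurable A -> lambda A = (mass A)%:E.
Proof. by move=> mA; rewrite /mass fineK// fin_num_measure. Qed.

Lemma mass_ge0 A : 0 <= mass A. Proof. exact: fine_ge0. Qed.

Lemma mass0 : mass set0 = 0. Proof. by rewrite /mass measure0. Qed.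

Lemma massT : mass setT = 1. Proof. by rewrite /mass probability_setT. Qed.

Lemma massU A B : measurable A -> measurable B -> A `&` B = set0 ->
  mass (A `|` B) = mass A + mass B.
Proof.
by move=> mA mB AB; rewrite /mass measureU// fineD ?fin_num_measure.
Qed.

Lemma mass_split A B : measurable A -> measurable B ->
  mass A = mass (A `&` B) + mass (A `\` B).
Proof.
move=> mA mB; rewrite -massU ?setUIDK//.
- exact: measurableI.
- exact: measurableD.
- by apply/seteqP; split=> // x [[_ Bx] [_ /(_ Bx)]].
Qed.

Lemma mass_le A B : measurable A -> measurable B -> A `<=` B -> mass A <= mass B.
Proof.
by move=> mA mB AB; apply: fine_le; rewrite ?fin_num_measure// le_measure ?inE.
Qed.

Lemma mass_le1 A : measurable A -> mass A <= 1.
Proof. by move=> mA; rewrite -massT; apply: mass_le. Qed.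

Lemma mass_bigcup (A : (set T)^nat) : (forall n, measurable (A n)) ->
  nondecreasing_seq A -> mass (A n) @[n --> \oo] --> mass (\bigcup_n A n).
Proof.
move=> mA ndA; have mU : measurable (\bigcup_n A n) by exact: bigcup_measurable.
apply: (@fine_cvg _ _ _ _ (lambda \o A)); rewrite -massE//.
exact: nondecreasing_cvg_mu.
Qed.

Section sub_sigma_algebra.
Variable F : set_system T.
Hypotheses (F_sigma : sigma_algebra [set: T] F) (FT : F `<=` measurable).

Lemma sub_measurableE : @measurable _ (g_sigma_algebraType F) = F.
Proof. exact: sigma_algebra_id. Qed.

Lemma F_setC A : F A -> F (~` A).
Proof. by case: F_sigma => _ + _ => /[apply]; rewrite setTD. Qed.

Lemma F_setI A B : F A -> F B -> F (A `&` B).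
Proof. by rewrite -sub_measurableE; exact: measurableI. Qed.

Definition additive_on_F (delta : set T -> R) := forall A B, F A -> F B ->
  A `&` B = set0 -> delta (A `|` B) = delta A + delta B.

(** Domination by [lambda] turns finite additivity into countable additivity, so
    [delta] is a charge on [F] and has a Hahn decomposition. *)
Lemma hahn_dominated (delta : set T -> R) (K : R) : additive_on_F delta ->
  (forall A, F A -> `|delta A| <= K * mass A) ->
  exists P, [/\ F P, forall E, F E -> E `<=` P -> 0 <= delta E &
    forall E, F E -> E `<=` ~` P -> delta E <= 0].
Proof.
move=> dadd dle.
pose nu (A : set (g_sigma_algebraType F)) : \bar R := (delta A)%:E.
have F0 : F set0 by case: F_sigma.
have nu0 : nu set0 = 0%E.
  congr EFin; apply/normr0_eq0/eqP; rewrite eq_le normr_ge0 andbT.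
  by rewrite (le_trans (dle _ F0))// mass0 mulr0.
have nu_fin A : measurable A -> nu A \is a fin_num by [].
have nu_sigma : semi_sigma_additive nu.
  move=> A mA tA mU.
  have FA n : F (A n) by rewrite -sub_measurableE.
  have FU : F (\bigcup_n A n) by rewrite -sub_measurableE.
  have FUn n : F (\big[setU/set0]_(0 <= i < n) A i).
    by rewrite -sub_measurableE; exact: bigsetU_measurable.
  have dn n : \sum_(0 <= i < n) nu (A i) =
      (delta (\big[setU/set0]_(0 <= i < n) A i))%:E.
    elim: n => [|n IHn]; first by rewrite !big_geq.
    rewrite !big_nat_recr//= IHn dadd//.
    rewrite big_mkord; apply: (@trivIset_bigsetUI _ predT) => //.
    by rewrite /predT /= trueE.
  under eq_fun do rewrite dn.
  apply/cvg_EFin; first by apply: nearW.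
  pose S n := \big[setU/set0]_(0 <= i < n) A i.
  change (delta (S n) @[n --> \oo] --> delta (\bigcup_n A n)).
  have SU n : S n `<=` \bigcup_n A n.
    by rewrite /S big_mkord -bigcup_mkord => x [i _ Aix]; exists i.
  have mS : mass (S n) @[n --> \oo] --> mass (\bigcup_n A n).
    rewrite -(bigcup_bigsetU_bigcup A) -cvg_shiftS /=.
    under eq_fun do rewrite /S big_mkord.
    apply: mass_bigcup => [n|m n mn].
      by apply: FT; have := FUn n.+1; rewrite big_mkord.
    by apply/subsetPset; exact: subset_bigsetU.
  have gap n : `|delta (\bigcup_n A n) - delta (S n)| <=
      K * (mass (\bigcup_n A n) - mass (S n)).
    have FD : F (\bigcup_n A n `\` S n).
      by rewrite setDE; apply: F_setI => //; exact: (F_setC (FUn n)).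
    have -> : delta (\bigcup_n A n) =
        delta (S n) + delta (\bigcup_n A n `\` S n).
      by rewrite -dadd ?setDUK//; [exact: FUn|apply/seteqP; split=> // x [? []]].
    rewrite [X in `|X|]addrC addKr (le_trans (dle _ FD))//.
    rewrite (mass_split (FT FU) (FT (FUn n))).
    by rewrite (setIidr (SU n)) addrC addKr.
  apply/cvgrPdist_le => e e0.
  have : K * (mass (\bigcup_n A n) - mass (S n)) @[n --> \oo] --> K * 0.
    rewrite -(subrr (mass (\bigcup_n A n))); apply: cvgMl_tmp.
    by apply: cvgB => //; exact: cvg_cst.
  rewrite mulr0 => /cvgr_le /(_ _ e0); apply: filterS => n.
  exact: le_trans (gap n).
pose nu' : {charge set (g_sigma_algebraType F) -> \bar R} := HB.pack nu
  (isCharge.Build _ _ _ nu nu0 nu_fin nu_sigma).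
have [P [N [[mP posP] [mN negN] PN _]]] := Hahn_decomposition nu'.
exists P; split=> [|E FE EP|E FE EP].
- by rewrite -sub_measurableE.
- by rewrite -lee_fin; apply: posP => //; rewrite sub_measurableE.
- rewrite -lee_fin; apply: negN; first by rewrite sub_measurableE.
  move=> x /EP nPx; have : (P `|` N) x by rewrite PN.
  by case.
Qed.

Hypothesis nowhere : nowhere_equivalent lambda F.

(** Nowhere equivalence yields a part [C1] of [C] that is not a trace of [F]. Let
    [P] be the region of [F] where [C1] takes at least half of [C]. Off [P] the
    set [C1] is small relative to [F], on [P] its complement in [C] is; if both
    these parts were null, [C1] would be the trace of [P] up to a null set. *)
Lemma half_subset C : measurable C -> 0 < mass C ->
  exists C', [/\ measurable C', C' `<=` C, 0 < mass C' &
    forall E, F E -> mass (E `&` C') <= 2^-1 * mass (E `&` C)].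
Proof.
move=> mC C0; have [|C1 [mC1 C1C C1n]] := nowhere mC.
  by rewrite massE// lte_fin.
pose delta E := 2 * mass (E `&` C1) - mass (E `&` C).
have mI A B : F A -> measurable B -> measurable (A `&` B).
  by move=> /FT *; exact: measurableI.
have UI A B X : A `&` B = set0 -> (A `&` X) `&` (B `&` X) = set0.
  by move=> AB; rewrite setIACA AB set0I.
have dadd : additive_on_F delta.
  move=> A B FA FB AB; rewrite /delta !setIUl !massU; try by [exact: mI|exact: UI].
  by lra.
have massI A X : F A -> measurable X -> mass (A `&` X) <= mass A.
  by move=> FA mX; apply: mass_le => //; [exact: mI|exact: FT].
have dle A : F A -> `|delta A| <= 2 * mass A.
  move=> FA; have := massI A C FA mC; have := massI A C1 FA mC1.
  have := mass_ge0 (A `&` C1); have := mass_ge0 (A `&` C).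
  by rewrite /delta ler_norml => *; apply/andP; split; lra.
have [P [FP Ppos Pneg]] := hahn_dominated dadd dle.
have mP := FT FP; have mCC1 := measurableD mC mC1.
have [z1|z1] := eqVneq (mass (C1 `\` P)) 0; last first.
  exists (C1 `\` P); split; [exact: measurableD|by move=> x [/C1C]| |].
    by rewrite lt_def z1 mass_ge0.
  move=> E FE; have FEP : F (E `\` P).
    by rewrite setDE; apply: F_setI => //; exact: F_setC.
  have := Pneg _ FEP (fun x => @snd _ _); rewrite /delta.
  have -> : (E `\` P) `&` C1 = E `&` (C1 `\` P) by apply/seteqP; split=> x /=; tauto.
  have : mass ((E `\` P) `&` C) <= mass (E `&` C).
    by apply: mass_le; [exact: mI|exact: mI|move=> x [[]]].
  lra.
have [z2|z2] := eqVneq (mass ((C `\` C1) `&` P)) 0; last first.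
  exists ((C `\` C1) `&` P); split; [exact: measurableI|by move=> x [[]]| |].
    by rewrite lt_def z2 mass_ge0.
  move=> E FE; have FEP : F (E `&` P) by exact: F_setI.
  have := Ppos _ FEP (fun x => @snd _ _); rewrite /delta.
  have : mass ((E `&` P) `&` C) <= mass (E `&` C).
    by apply: mass_le; [exact: mI|exact: mI|move=> x [[]]].
  rewrite (mass_split (mI _ _ FEP mC) mC1).
  have -> : E `&` P `&` C `&` C1 = E `&` P `&` C1.
    by rewrite -setIA (setIidr C1C).
  have -> : (E `&` P `&` C) `\` C1 = E `&` ((C `\` C1) `&` P).
    by apply/seteqP; split=> x /=; tauto.
  lra.
exfalso; have := C1n (C `&` P) (ex_intro2 _ _ P FP erefl).
have -> : C1 `+` (C `&` P) = (C1 `\` P) `|` ((C `\` C1) `&` P).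
  apply/seteqP; split=> x.
    move=> [[C1x nCP]|[[Cx Px] nC1]]; [left|right]; split=> // Px.
    by apply: nCP; split=> //; exact: C1C.
  by move=> [[C1x nPx]|[[Cx nC1] Px]]; [left; split=> // -[_ /nPx]|right].
rewrite massE; last by apply: measurableU; [exact: measurableD|exact: measurableI].
rewrite massU ?z1 ?z2 ?addr0 ?ltxx//; [exact: measurableD|exact: measurableI|].
by apply/seteqP; split=> // x [[_ nPx] [_ /nPx]].
Qed.

Lemma small_subset (n : nat) C : measurable C -> 0 < mass C ->
  exists C', [/\ measurable C', C' `<=` C, 0 < mass C' &
    forall E, F E -> mass (E `&` C') <= 2^-1 ^+ n * mass (E `&` C)].
Proof.
move=> mC C0; elim: n => [|n [C1 [mC1 C1C C10 IH]]].
  by exists C; split=> // E _; rewrite expr0 mul1r.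
have [C2 [mC2 C2C1 C20 H2]] := half_subset mC1 C10.
exists C2; split=> //; first exact: subset_trans C2C1 C1C.
move=> E FE; apply: le_trans (H2 _ FE) _.
by rewrite exprS -mulrA ler_wpM2l ?IH// invr_ge0.
Qed.

(** Greedy choice: each step comes within [n.+1%:R^-1] of the largest mass
    available above the current set, so nothing can be gained above the union. *)
Lemma exhaustion (S : set (set T)) D0 : S D0 -> (forall D, S D -> measurable D) ->
  (forall D : (set T)^nat, (forall n, S (D n)) -> nondecreasing_seq D ->
    S (\bigcup_n D n)) ->
  exists2 M, S M & forall M', S M' -> M `<=` M' -> mass M' <= mass M.
Proof.
move=> SD0 Sm Scup.
pose step_spec (n : nat) D D' := S D -> [/\ S D', D `<=` D' &
  forall D'', S D'' -> D `<=` D'' -> mass D'' <= mass D' + n.+1%:R^-1].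
have /choice[step stepP] : forall nD : nat * set T, exists D', step_spec nD.1 nD.2 D'.
  move=> [n D] /=; have [SD|nSD] := pselect (S D); last by exists D => /nSD.
  pose masses := [set mass D' | D' in [set D' | S D' /\ D `<=` D']].
  have hs : has_sup masses.
    split; first by exists (mass D), D; first by split.
    by exists 1 => _ [D' [/Sm mD' _] <-]; exact: mass_le1.
  have n0 : 0 < n.+1%:R^-1 :> R by rewrite invr_gt0.
  have [_ [D' [SD' DD'] <-] D'sup] := sup_adherent n0 hs.
  exists D' => _; split=> // D'' SD'' DD''.
  have : mass D'' <= sup masses by apply: (ub_le_sup hs.2); exists D''.
  move=> /le_trans; apply; apply: ltW.
  by rewrite -ltrBlDr.
pose D := fix D n := if n is m.+1 then step (m, D m) else D0.
have SD n : S (D n) by elim: n => // n /(stepP (n, D n))[].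
have ndD : nondecreasing_seq D.
  apply/nondecreasing_seqP => n; apply/subsetPset.
  by have [] := stepP (n, D n) (SD n).
exists (\bigcup_n D n) => [|M SM DM]; first exact: Scup.
apply/ler_addgt0Pr => e e0.
have [n ne] : exists n, n.+1%:R^-1 < e.
  by have [n _ /(_ n (leqnn _))] := near_infty_natSinv_lt (PosNum e0); exists n.
have [_ _ /(_ M SM) H] := stepP (n, D n) (SD n).
apply: le_trans (H _) _.
  by apply: subset_trans DM => x Dx; exists n.
rewrite lerD ?(ltW ne)//; apply: mass_le; [exact: Sm (SD n.+1)| |].
  by apply: bigcup_measurable => k _; exact: Sm.
by move=> x Dx; exists n.+1.
Qed.

(** Take [M] maximal among the subsets of [D] whose trace stays below [nu]. If
    [nu] were not reached, the remaining measure [nu'] would exceed a small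
    multiple of the trace of [D `\` M] on some [P] of [F] with positive mass
    there, and a part of [P `&` (D `\` M)] that is small enough relative to [F]
    could still be added to [M]. *)
Lemma carve D (nu : set T -> R) : measurable D -> additive_on_F nu ->
  (forall E, F E -> 0 <= nu E <= mass (E `&` D)) ->
  exists D', [/\ measurable D', D' `<=` D &
    forall E, F E -> mass (E `&` D') = nu E].
Proof.
move=> mD nuadd nuD.
have mI A B : F A -> measurable B -> measurable (A `&` B).
  by move=> /FT *; exact: measurableI.
pose S D' := [/\ measurable D', D' `<=` D &
  forall E, F E -> mass (E `&` D') <= nu E].
have [|D' []//|A SA ndA|M [mM MD Mnu] Mmax] := @exhaustion S set0.
- by split=> // E /nuD/andP[]; rewrite setI0 mass0.
- have mA n : measurable (A n) by case: (SA n).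
  split; first exact: bigcup_measurable.
    by move=> x [n _]; have [_ + _] := SA n; apply.
  move=> E FE; rewrite setI_bigcupr.
  have : mass (E `&` A n) @[n --> \oo] --> mass (\bigcup_n (E `&` A n)).
    apply: mass_bigcup => [n|m n mn]; first exact: mI.
    apply/subsetPset; apply: setIS; apply/subsetPset.
    exact: ndA.
  move=> /cvgr_to_le; apply; apply: nearW => n.
  by have [_ _] := SA n; exact.
exists M; split=> // E0 FE0; apply: contrapT => /eqP ne.
pose nu' E := nu E - mass (E `&` M).
pose C := D `\` M; have mC : measurable C by exact: measurableD.
have massC E : F E -> mass (E `&` D) = mass (E `&` M) + mass (E `&` C).
  move=> FE; rewrite (mass_split (mI _ _ FE mD) mM).
  by congr (mass _ + mass _); rewrite -?setIA ?(setIidr MD)// setIDA.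
have massUI A B X : F A -> F B -> measurable X -> A `&` B = set0 ->
    mass ((A `|` B) `&` X) = mass (A `&` X) + mass (B `&` X).
  move=> FA FB mX AB; rewrite setIUl massU//; try exact: mI.
  by rewrite setIACA AB set0I.
have nu'add : additive_on_F nu'.
  by move=> A B FA FB AB; rewrite /nu' nuadd// massUI//; lra.
have nu'_ge0 E : F E -> 0 <= nu' E by move=> FE; rewrite subr_ge0 Mnu.
have nu'C E : F E -> nu' E <= mass (E `&` C).
  by move=> FE; have := nuD _ FE; rewrite massC// /nu' => /andP[]; lra.
have nu'T : 0 < nu' setT.
  rewrite -(setUv E0) nu'add ?setICr//; last exact: F_setC.
  rewrite ltr_wpDr//; first by apply: nu'_ge0; exact: F_setC.
  by rewrite subr_gt0 lt_neqAle ne Mnu.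
have [n nT] : exists n, 2^-1 ^+ n < nu' setT.
  have [n _ /(_ n (leqnn _))] := near_infty_natSinv_expn_lt (PosNum nu'T).
  by rewrite /= div1r -exprVn; exists n.
pose delta E := nu' E - 2^-1 ^+ n * mass (E `&` C).
have pow0 : 0 <= 2^-1 ^+ n :> R by rewrite exprn_ge0.
have pow1 : 2^-1 ^+ n <= 1 :> R by apply: exprn_ile1; lra.
have dadd : additive_on_F delta.
  by move=> A B FA FB AB; rewrite /delta nu'add// massUI// mulrDr; lra.
have dle A : F A -> `|delta A| <= 1 * mass A.
  move=> FA; have := nu'C A FA; have := nu'_ge0 A FA.
  have : mass (A `&` C) <= mass A by apply: mass_le => //; [exact: mI|exact: FT].
  have : 2^-1 ^+ n * mass (A `&` C) <= mass (A `&` C).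
    by rewrite ler_piMl ?mass_ge0.
  have : 0 <= 2^-1 ^+ n * mass (A `&` C) by rewrite mulr_ge0 ?mass_ge0.
  rewrite /delta ler_norml; move: (_ ^+ _ * _) => x *; apply/andP; split; lra.
have [P [FP Ppos Pneg]] := hahn_dominated dadd dle.
have dP : 0 < delta P.
  have : 0 < delta setT.
    rewrite subr_gt0; apply: le_lt_trans nT; by rewrite setTI ler_piMr// mass_le1.
  rewrite -(setUv P) dadd ?setICr//; last exact: F_setC.
  by have := Pneg _ (F_setC FP) (fun x => id); lra.
have PC0 : 0 < mass (P `&` C).
  apply: lt_le_trans (nu'C _ FP); move: dP; rewrite subr_gt0.
  by apply: le_lt_trans; rewrite mulr_ge0 ?mass_ge0.
have [C2 [mC2 C2PC C20 C2le]] := small_subset n (mI _ _ FP mC) PC0.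
have MC2 : M `&` C2 = set0.
  by apply/seteqP; split=> // x [Mx /C2PC[_ [_ /(_ Mx)]]].
have SM2 : S (M `|` C2).
  split; [exact: measurableU|by move=> x [/MD//|/C2PC[_ []]]|].
  move=> E FE; rewrite setIUr massU; [|exact: mI|exact: mI|].
    have FEP : F (E `&` P) by exact: F_setI.
    have := Ppos _ FEP (fun x => @snd _ _); have := C2le _ FE.
    have : nu' E = nu' (E `&` P) + nu' (E `&` ~` P).
      rewrite -nu'add -?setIUr ?setUv ?setIT//.
        by apply: F_setI => //; exact: F_setC.
      by rewrite setIACA setICr setI0.
    have : 0 <= nu' (E `&` ~` P).
      by apply/nu'_ge0/F_setI => //; exact: F_setC.
    by rewrite /delta -setIA /nu'; lra.
  by rewrite setIACA MC2 setI0.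
have := Mmax _ SM2 (@subsetUl _ _ _).
by rewrite massU//; lra.
Qed.

(** * Strategies with values in Cantor space *)

(** Most recent bit first, so that refining a cell is [cons]. *)
Fixpoint bits (x : nat -> bool) n : seq bool :=
  if n is m.+1 then x m :: bits x m else [::].

Definition cell (k : T -> nat -> bool) (s : seq bool) : set T :=
  [set t | bits (k t) (size s) = s].

Definition strategy (k : T -> nat -> bool) := forall n, measurable [set t | k t n].

Lemma cell_nil k : cell k [::] = setT.
Proof. by apply/seteqP. Qed.

Lemma cell_cons k b s : cell k (b :: s) = cell k s `&` [set t | k t (size s) = b].
Proof.
rewrite /cell; apply/seteqP; split=> t /=; first by case=> -> ->.
by case=> -> ->.
Qed.

Lemma measurable_cell k s : strategy k -> measurable (cell k s).
Proof.
move=> mk; elim: s => [|b s IHs]; first by rewrite cell_nil.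
rewrite cell_cons; apply: measurableI => //; case: b; first exact: mk.
rewrite (_ : mkset _ = ~` [set t | k t (size s)]); first exact/measurableC/mk.
by apply/seteqP; split=> t /=; [move=> ->|move/negP/negbTE].
Qed.

(** The cells are carved one after the other down the binary tree: inside the
    cell [s] already built, [L (true :: s)] is dominated by the trace of that
    cell, and the remainder has trace [L (false :: s)]. *)
Theorem realization (L : seq bool -> set T -> R) :
  (forall s, additive_on_F (L s)) ->
  (forall s E, F E -> 0 <= L s E) ->
  (forall E, F E -> L [::] E = mass E) ->
  (forall s E, F E -> L s E = L (true :: s) E + L (false :: s) E) ->
  exists2 k, strategy k & forall s E, F E -> mass (E `&` cell k s) = L s E.
Proof.
move=> Ladd L0 Lnil Lcons.
have mI A B : F A -> measurable B -> measurable (A `&` B).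
  by move=> /FT *; exact: measurableI.
pose spec D nu D' := measurable D -> additive_on_F nu ->
  (forall E, F E -> 0 <= nu E <= mass (E `&` D)) ->
  [/\ measurable D', D' `<=` D & forall E, F E -> mass (E `&` D') = nu E].
have /choice[cut cutP] : forall Dnu : set T * (set T -> R),
    exists D', spec Dnu.1 Dnu.2 D'.
  move=> [D nu]; have [[mD nuadd nuD]|H] := pselect [/\ measurable D, additive_on_F nu &
      forall E, F E -> 0 <= nu E <= mass (E `&` D)].
    by have [D' HD'] := carve mD nuadd nuD; exists D'.
  by exists set0 => mD nuadd nuD; case: H.
pose D := fix D s := match s with
  | [::] => setT
  | b :: s' => let D1 := cut (D s', L (true :: s')) in if b then D1 else D s' `\` D1
  end.
have DP s : measurable (D s) /\ forall E, F E -> mass (E `&` D s) = L s E.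
  elim: s => [|b s [mD DL]].
    split=> [|E FE]; first exact: measurableT.
    by rewrite /= setIT Lnil.
  have [|m1 s1 e1] := cutP (D s, L (true :: s)) mD (Ladd _).
    by move=> E FE /=; rewrite L0//= DL// (Lcons s)// lerDl L0.
  case: b => //; split; first exact: measurableD.
  move=> E FE; have := mass_split (mI _ _ FE mD) m1.
  rewrite -setIA (setIidr s1) e1// DL// (Lcons s)// setIDA => /addrI ->.
  by rewrite /=.
pose w t := fix w n := if n is m.+1 then `[< D (true :: w m) t >] :: w m else [::].
pose k t n := `[< D (true :: w t n) t >].
have bitsw t n : bits (k t) n = w t n by elim: n => //= n ->.
have cellD s : cell k s = D s.
  elim: s => [|b s IHs]; first by rewrite cell_nil.
  rewrite cell_cons; apply/seteqP; split=> t.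
    move=> [cs /=]; rewrite /k -bitsw cs -IHs/=; move: cs; rewrite IHs => Ds.
    by case: b => /asboolP //= nD; split.
  have sD : D (b :: s) `<=` D s.
    case: b; last by move=> ? [].
    have [|_ + _] := cutP (D s, L (true :: s)) (DP s).1 (Ladd _) => //= E FE.
    by rewrite L0//= (DP s).2// (Lcons s)// lerDl L0.
  move=> Dt; have cs : cell k s t by rewrite IHs; exact: sD.
  split=> //=; rewrite /k -bitsw cs.
  by case: b {sD} Dt => [|[_ ?]]; [move/asboolP|exact: asboolF].
exists k => [n|s E FE]; last by rewrite cellD; exact: (DP s).2.
rewrite (_ : mkset _ = \bigcup_(s in [set: n.-tuple bool]) D (true :: s)).
  apply: fin_bigcup_measurable => // s _; exact: (DP _).1.
apply/seteqP; split=> [t /= ktn|t [s _]]; last first.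
  by rewrite -(cellD (true :: s)) cell_cons size_tuple => -[].
have sz : size (bits (k t) n) == n by elim: (n) => //= m /eqP ->.
exists (Tuple sz) => //.
suff : cell k (true :: bits (k t) n) t by rewrite cellD.
by rewrite cell_cons /cell /= (eqP sz).
Qed.
End sub_sigma_algebra.
End mass.

(** * Cantor space *)

Lemma cantor_cvgP (F : set_system cantor_space) (x : cantor_space) : Filter F ->
  F --> x <-> forall m, \forall y \near F, (y : nat -> bool) m = (x : nat -> bool) m.
Proof.
move=> FF; have := @pointwise_cvgP nat bool F x FF.
move=> H; split=> [/H Fx m|Fx].
  apply: ((Fx m) (fun b : bool => b = (x : nat -> bool) m)).
  exact/principal_filterP.
apply/H => m B /= /principal_filterP Bxm.
by apply: filterS (Fx m) => y /= ->.
Qed.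

Lemma size_bits x n : size (bits x n) = n.
Proof. by elim: n => //= n ->. Qed.

Lemma cantor_near (x : cantor_space) n :
  \forall y \near x, bits y n = bits x n.
Proof.
elim: n => [|n IHn]; first by near=> y.
have /cantor_cvgP/(_ n) xn : nbhs x --> x by [].
by near do [rewrite /=; congr (_ :: _)].
Unshelve. all: by end_near. Qed.

Lemma bits_nth x n m : (m < n)%N -> nth false (rev (bits x n)) m = x m.
Proof.
elim: n => // n IHn; rewrite ltnS leq_eqVlt /= rev_cons nth_rcons size_rev size_bits.
by case/orP => [/eqP ->|mn]; rewrite ?ltnn ?eqxx// mn IHn.
Qed.

Lemma bits_eqP x y n : bits x n = bits y n <-> forall m, (m < n)%N -> x m = y m.
Proof.
split=> [xy m mn|]; first by rewrite -(bits_nth x mn) xy bits_nth.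
elim: n => //= n IHn xy; rewrite xy// IHn// => m mn; apply: xy; exact: ltnW.
Qed.

Lemma cantor_nbhsP (x : cantor_space) (W : set cantor_space) :
  nbhs x W -> exists n, forall y, bits y n = bits x n -> W y.
Proof.
move=> xW; apply: contrapT => /forallNP H.
have /choice[y yP] n : exists y, bits y n = bits x n /\ ~ W y.
  by have /existsNP[y /not_implyP] := H n; exists y.
have yx : (y : nat -> cantor_space) @ \oo --> x.
  apply/cantor_cvgP => m; exists m.+1 => // n /= mn.
  by have /bits_eqP := (yP n).1; exact.
have [n _ /(_ n (leqnn _))] := yx W xW.
by have [] := yP n.
Qed.

(** Uniform continuity, expressed by the number of bits read. *)
Lemma cantor_modulus (R : realType) (u : cantor_space -> R) : continuous u ->
  forall e, 0 < e -> exists n, forall x y, bits x n = bits y n -> `|u x - u y| <= e.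
Proof.
move=> cu e e0.
have /compact_near_coveringP cov := cantor_space_compact.
have [x _|n _ /(_ n (leqnn _)) H] := cov nat \oo
  (fun n x => forall y, bits x n = bits y n -> `|u x - u y| <= e) _.
  have e2 : 0 < e / 2 by rewrite divr_gt0.
  have /cantor_nbhsP[n nP] : \forall y \near x, `|u x - u y| < e / 2.
    by have /cvgrPdist_lt/(_ _ e2) := cu x.
  exists ([set x' | bits x' n = bits x n], [set m | (n <= m)%N]).
    by split; [exact: cantor_near|exact: nbhs_infty_ge].
  move=> [x' m] /= [x'x nm] y x'y.
  have := nP _ x'x; have : `|u x - u y| < e / 2.
    apply: nP; rewrite -x'x.
    by apply/bits_eqP => i ni; move/bits_eqP: x'y => -> //; exact: leq_trans nm.
  rewrite !ltr_norml ler_norml => /andP[? ?] /andP[? ?]; apply/andP; split; lra.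
by exists n => x y; exact: H.
Qed.

(** * Joint measurability of Caratheodory functions *)

Section caratheodory.
Context d (T : measurableType d) (R : realType) (A : pmetricType R).

Lemma measurable_countable_choice d' (S : measurableType d')
    (J : S -> nat) (g : nat -> S -> R) :
  (forall j, measurable [set x | J x = j]) ->
  (forall j, measurable_fun setT (g j)) ->
  measurable_fun setT (fun x => g (J x) x).
Proof.
move=> mJ mg _ B mB; rewrite setTI.
rewrite (_ : _ @^-1` _ = \bigcup_j ([set x | J x = j] `&` g j @^-1` B)).
  apply: bigcup_measurable => j _; apply: measurableI => //.
  by rewrite -[X in measurable X]setTI; exact: mg.
apply/seteqP; split=> [x Bx|x [j _ [/= -> //]]].
by exists (J x).
Qed.

(** The function is the pointwise limit of the functions obtained by replacing
    [a] by the first point of a dense sequence at distance less than [1 / n.+1];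
    each of these is measurable since only countably many points occur. *)
Lemma joint_measurable (a_ : nat -> A) (phi : T * A -> R) :
  (forall (a : A) e, 0 < e -> exists j, (ball (a_ j) e)° a) ->
  (forall a, measurable_fun setT (fun t => phi (t, a))) ->
  (forall t, continuous (fun a => phi (t, a))) ->
  measurable_fun [set: (T * borel A)%type] phi.
Proof.
move=> dense mphi cphi.
have exb n (x : T * borel A) : exists j, `[< (ball (a_ j) n.+1%:R^-1)° x.2 >].
  have n0 : 0 < n.+1%:R^-1 :> R by rewrite invr_gt0.
  by have [j xj] := dense x.2 _ n0; exists j; apply/asboolP.
pose J n x := ex_minn (exb n x).
have JP n x : (ball (a_ (J n x)) n.+1%:R^-1)° x.2.
  by rewrite /J; case: ex_minnP => j /asboolP.
have mball n j : measurable [set x : T * borel A | (ball (a_ j) n.+1%:R^-1)° x.2].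
  rewrite -[X in measurable X]setTI.
  apply: (@measurable_snd _ _ T (borel A) measurableT (ball (a_ j) n.+1%:R^-1)°).
  by apply: sub_sigma_algebra; exact: open_interior.
have mJ n j : measurable [set x | J n x = j].
  rewrite (_ : mkset _ = [set x : T * borel A | (ball (a_ j) n.+1%:R^-1)° x.2] `\`
      \bigcup_(i in `I_j) [set x : T * borel A | (ball (a_ i) n.+1%:R^-1)° x.2]).
    by apply: measurableD => //; apply: bigcup_measurable => i _.
  apply/seteqP; split=> x; rewrite /J /=; case: ex_minnP => i /asboolP xi imin.
    move=> <-; split=> // -[l /= li xl].
    by have := imin l (introT (asboolP _) xl); rewrite leqNgt li.
  move=> [xj nxj]; apply/eqP; rewrite eqn_leq imin/=; last exact/asboolP.
  by rewrite leqNgt; apply/negP => ij; apply: nxj; exists i.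
apply/measurable_EFinP.
apply: (emeasurable_fun_cvg (fun n x => (phi (x.1, a_ (J n x)))%:E)).
  move=> n; apply/measurable_EFinP.
  apply: (measurable_countable_choice (g := fun j x => phi (x.1, a_ j)) (mJ n)) => j.
  exact: measurableT_comp (mphi (a_ j)) measurable_fst.
move=> [t a] _ /=; apply/cvg_EFin; first exact: nearW.
apply: (@cvg_comp _ _ _ (fun n => a_ (J n (t, a))) (fun b => phi (t, b)) _ (nbhs a)).
  apply/cvg_ballP => e e0; near=> n.
  apply/ball_sym; apply: le_ball (interior_subset (JP n (t, a))).
  by apply: ltW; near: n; exact: (near_infty_natSinv_lt (PosNum e0)).
exact: cphi.
Unshelve. all: by end_near. Qed.

End caratheodory.

(** * Playing an action through Cantor space *)

Section cantor_param.
Context d (T : measurableType d) (R : realType) (A : pmetricType R).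
Variable pi : cantor_space -> A.
Hypothesis pi_cont : continuous pi.

Definition play (k : T -> nat -> bool) (t : T) : A := pi (k t).

Lemma measurable_play k : strategy k -> measurable_fun setT (play k : T -> borel A).
Proof.
move=> mk; apply: (@measurability _ _ T (borel A) setT (play k) (@open A)) => //.
move=> _ [W oW <-]; rewrite setTI.
pose good := [set s : seq bool | cell k s `<=` play k @^-1` W].
rewrite (_ : _ @^-1` _ = \bigcup_(s in good) cell k s); last first.
  apply/seteqP; split=> [t Wt|t [s gs]]; last exact: gs.
  have /cantor_nbhsP[n nP] : nbhs (k t : cantor_space) (pi @^-1` W).
    by apply: pi_cont; apply: open_nbhs_nbhs.
  exists (bits (k t) n); last by rewrite /cell /= size_bits.
  by move=> t'; rewrite /cell /= size_bits => /nP.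
rewrite bigcup_mkcond; apply: countable_bigcupT_measurable; first exact: countableP.
move=> s; case: ifPn => // _; exact: measurable_cell.
Qed.

(** Any other point of the cylinder of [s] would do as well. *)
Definition pad (s : seq bool) : cantor_space := fun m => nth false (rev s) m.

Lemma bits_pad x n : bits (pad (bits x n)) n = bits x n.
Proof.
by apply/bits_eqP => m mn; rewrite /pad bits_nth.
Qed.

End cantor_param.

(** * Integrals of bounded functions *)

Section bounded_integrals.
Context d (T : measurableType d) (R : realType) (lambda : probability T R).

Definition bounded_measurable (g : T -> R) :=
  measurable_fun setT g /\ exists B, forall t, `|g t| <= B.

Lemma bounded_measurable_integrable g : bounded_measurable g ->
  lambda.-integrable setT (EFin \o g).
Proof.
move=> [mg [B gB]]; apply: measurable_bounded_integrable => //.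
  by apply: (le_lt_trans (probability_le1 lambda measurableT)); exact: ltry.
exists B; split; first exact: num_real.
by move=> M BM t _; exact: le_trans (gB t) (ltW BM).
Qed.

Lemma bounded_measurableD g h : bounded_measurable g -> bounded_measurable h ->
  bounded_measurable (fun t => g t + h t).
Proof.
move=> [mg [B gB]] [mh [C hC]]; split; first exact: measurable_funD.
by exists (B + C) => t; rewrite (le_trans (ler_normD _ _))// lerD.
Qed.

Lemma bounded_measurableM g h : bounded_measurable g -> bounded_measurable h ->
  bounded_measurable (fun t => g t * h t).
Proof.
move=> [mg [B gB]] [mh [C hC]]; split; first exact: measurable_funM.
by exists (B * C) => t; rewrite normrM ler_pM.
Qed.

Lemma bounded_measurable_cst c : bounded_measurable (fun=> c).
Proof. by split; [exact: measurable_cst|exists `|c|]. Qed.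

Lemma bounded_measurableN g : bounded_measurable g ->
  bounded_measurable (fun t => - g t).
Proof.
move=> [mg [B gB]]; split; first exact: measurable_funN.
by exists B => t; rewrite normrN.
Qed.

Lemma bounded_measurableB g h : bounded_measurable g -> bounded_measurable h ->
  bounded_measurable (fun t => g t - h t).
Proof. by move=> bg /bounded_measurableN; exact: bounded_measurableD. Qed.

Lemma bounded_measurable_indic E : measurable E -> bounded_measurable (\1_E).
Proof.
move=> mE; split; first exact: measurable_indic.
by exists 1 => t; rewrite indicE ger0_norm// lern1 leq_b1.
Qed.

Lemma integral_indic_mass E : measurable E -> \int[lambda]_t \1_E t = mass lambda E.
Proof. by move=> mE; rewrite /Rintegral integral_indic// setIT. Qed.

Lemma bounded_measurable_sum (I : Type) (r : seq I) (g : I -> T -> R) :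
  (forall i, bounded_measurable (g i)) ->
  bounded_measurable (fun t => \sum_(i <- r) g i t) /\
  \int[lambda]_t (\sum_(i <- r) g i t) = \sum_(i <- r) \int[lambda]_t g i t.
Proof.
move=> bg; elim: r => [|i r [IHb IHi]].
  under eq_fun do rewrite big_nil; split; first exact: bounded_measurable_cst.
  by rewrite big_nil Rintegral_cst// mul0r.
under eq_fun do rewrite big_cons; split; first exact: bounded_measurableD.
by rewrite big_cons RintegralD ?IHi//; exact: bounded_measurable_integrable.
Qed.

Lemma integral_close g h (e B : R) G : bounded_measurable g -> bounded_measurable h ->
  0 <= B -> measurable G ->
  (forall t, `|g t - h t| <= B) -> (forall t, G t -> `|g t - h t| <= e) ->
  `|\int[lambda]_t g t - \int[lambda]_t h t| <= `|e| + B * mass lambda (~` G).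
Proof.
move=> bg bh B0 mG ghB ghe.
have bgh := bounded_measurableB bg bh.
rewrite -RintegralB//; try exact: bounded_measurable_integrable.
apply: le_trans (le_normr_Rintegral _ _) _ => //.
  exact: bounded_measurable_integrable.
have mnG : measurable (~` G) by exact: measurableC.
have bb : bounded_measurable (fun t => `|e| + B * \1_(~` G) t).
  apply: bounded_measurableD; first exact: bounded_measurable_cst.
  apply: bounded_measurableM; first exact: bounded_measurable_cst.
  exact: bounded_measurable_indic.
apply: (@le_trans _ _ (\int[lambda]_t (`|e| + B * \1_(~` G) t))).
  apply: le_Rintegral => //; last first.
  - move=> t _; have [Gt|nGt] := pselect (G t).
      rewrite (le_trans (ghe _ Gt))// (le_trans (ler_norm e))// lerDl.
      by rewrite mulr_ge0.
    rewrite indicE mem_set// mulr1 (le_trans (ghB t))// lerDr//.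
  - exact: bounded_measurable_integrable.
  - apply: bounded_measurable_integrable; case: bgh => m [C HC]; split.
      exact: measurableT_comp.
    by exists C => t; rewrite normr_id.
have b1 := bounded_measurable_indic mnG.
have bB := bounded_measurableM (bounded_measurable_cst B) b1.
rewrite RintegralD//; try exact: bounded_measurable_integrable.
  rewrite RintegralZl//; last exact: bounded_measurable_integrable.
  by rewrite integral_indic_mass// Rintegral_cst// [fine _](massT lambda) mulr1.
apply: bounded_measurable_integrable; exact: bounded_measurable_cst.
Qed.

End bounded_integrals.

Lemma layer_cake (R : realType) (N : nat) (x : R) : 0 <= x <= N%:R ->
  `|x - \sum_(j < N) (j.+1%:R <= x)%R%:R| <= 1.
Proof.
move=> /andP[x0 xN].
have -> : \sum_(j < N) (j.+1%:R <= x)%R%:R = (Num.truncn x)%:R :> R.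
  rewrite -natr_sum; congr (_%:R).
  have : (Num.truncn x <= N)%N.
    by rewrite -(ler_nat R) (le_trans _ xN)// truncn_le.
  move=> nN; under eq_bigr do rewrite -truncn_gt_nat.
  under eq_bigr do rewrite -[nat_of_bool _]muln1 mulnbl.
  by rewrite -big_mkcond/= -(big_ord_widen _ (fun=> 1%N) nN) sum1_card card_ord.
have /andP[] := truncn_itv x0; rewrite -natr1 => ? ?.
by rewrite ler_norml; apply/andP; split; lra.
Qed.

(** * Functionals determined by cell masses *)

Section tame.
Context d (T : measurableType d) (R : realType) (lambda : probability T R).
Variable F : set_system T.
Hypotheses (F_sigma : sigma_algebra [set: T] F) (FT : F `<=` measurable).

Local Notation functional := ((T -> nat -> bool) -> R).
Local Notation mass := (mass lambda).

Inductive cell_span : functional -> Prop :=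
| cell_span_basic E s : F E -> cell_span (fun k => mass (E `&` cell k s))
| cell_span0 : cell_span (fun=> 0)
| cell_span_add J1 J2 : cell_span J1 -> cell_span J2 ->
    cell_span (fun k => J1 k + J2 k)
| cell_span_scale c J : cell_span J -> cell_span (fun k => c * J k).

(** Convergence of cell masses and linear relations between them carry over to
    uniform limits of [cell_span], hence to all tame functionals. *)
Definition tame (J : functional) := forall e, 0 < e ->
  exists2 J', cell_span J' & forall k, strategy k -> `|J k - J' k| <= e.

Lemma tame_lim (J : functional) :
  (forall e, 0 < e -> exists2 J', tame J' &
    forall k, strategy k -> `|J k - J' k| <= e) ->
  tame J.
Proof.
move=> H e e0; have e2 : 0 < e / 2 by rewrite divr_gt0.
have [J1 /(_ _ e2)[J2 sJ2 J12] JJ1] := H _ e2.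
exists J2 => // k mk; rewrite (splitr e) (le_trans (ler_distD (J1 k) _ _))//.
by rewrite lerD ?JJ1 ?J12.
Qed.

Lemma eq_tame (J1 J2 : functional) : (forall k, strategy k -> J1 k = J2 k) ->
  tame J1 -> tame J2.
Proof.
move=> J12 tJ1; apply: tame_lim => e /ltW e0; exists J1 => // k mk.
by rewrite J12// subrr normr0.
Qed.

Lemma tame_span J : cell_span J -> tame J.
Proof. by move=> sJ e /ltW e0; exists J => // k _; rewrite subrr normr0. Qed.

Lemma tameD J1 J2 : tame J1 -> tame J2 -> tame (fun k => J1 k + J2 k).
Proof.
move=> t1 t2 e e0; have e2 : 0 < e / 2 by rewrite divr_gt0.
have [J1' s1 H1] := t1 _ e2; have [J2' s2 H2] := t2 _ e2.
exists (fun k => J1' k + J2' k); first exact: cell_span_add.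
move=> k mk; rewrite opprD addrACA (splitr e) (le_trans (ler_normD _ _))//.
by rewrite lerD ?H1 ?H2.
Qed.

Lemma tameZ c J : tame J -> tame (fun k => c * J k).
Proof.
move=> tJ e e0; have c0 : 0 < `|c| + 1 by rewrite ltr_wpDl.
have [J' sJ' H] := tJ _ (divr_gt0 e0 c0).
exists (fun k => c * J' k); first exact: cell_span_scale.
move=> k mk; rewrite -mulrBr normrM.
apply: (@le_trans _ _ ((`|c| + 1) * (e / (`|c| + 1)))).
  by rewrite ler_pM ?H// lerDl.
by rewrite mulrC divfK// gt_eqF.
Qed.

Lemma tame_sum (I : Type) (r : seq I) (J : I -> functional) :
  (forall i, tame (J i)) -> tame (fun k => \sum_(i <- r) J i k).
Proof.
move=> tJ; elim: r => [|i r IHr].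
  by apply: eq_tame (tame_span cell_span0) => k _; rewrite big_nil.
apply: eq_tame (tameD (tJ i) IHr) => k _.
by rewrite big_cons.
Qed.

Lemma bounded_measurable_cell k s : strategy k ->
  bounded_measurable (\1_(cell k s) : T -> R).
Proof. by move=> mk; apply: bounded_measurable_indic; exact: measurable_cell. Qed.

Definition F_measurable (q : T -> R) := forall B, measurable B -> F (q @^-1` B).

Lemma F_measurableW q : F_measurable q -> measurable_fun setT q.
Proof. by move=> Fq _ B mB; rewrite setTI; exact/FT/Fq. Qed.

Lemma tame_indicator E s : F E ->
  tame (fun k => \int[lambda]_t (\1_E t * \1_(cell k s) t)).
Proof.
move=> FE; apply: eq_tame (tame_span (cell_span_basic s FE)) => k mk.
have mEk : measurable (E `&` cell k s).
  by apply: measurableI; [exact: FT|exact: measurable_cell].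
rewrite -integral_indic_mass//; apply: eq_Rintegral => t _.
by rewrite indicI.
Qed.

(** The layer-cake formula with [N] levels of height [M^-1] approximates [q]
    uniformly by [F]-simple functions. *)
Lemma tame_product q s (B : R) : F_measurable q -> (forall t, 0 <= q t <= B) ->
  tame (fun k => \int[lambda]_t (q t * \1_(cell k s) t)).
Proof.
move=> Fq qB; apply: tame_lim => e e0.
have [m] : exists m, m.+1%:R^-1 < e.
  by have [n _ /(_ n (leqnn _))] := near_infty_natSinv_lt (PosNum e0); exists n.
set M : R := m.+1%:R => me.
have M0 : 0 < M by rewrite /M.
pose N := (Num.truncn (M * B)).+1.
pose E j := q @^-1` [set x | j.+1%:R <= M * x].
have FE j : F (E j).
  apply: Fq; rewrite (_ : mkset _ = [set` `[j.+1%:R / M, +oo[]) //.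
  by apply/seteqP; split=> x /=; rewrite in_itv/= andbT ler_pdivrMr// mulrC.
exists (fun k => \sum_(j < N) M^-1 *
    \int[lambda]_t (\1_(E j) t * \1_(cell k s) t)).
  by apply: tame_sum => j; apply: tameZ; exact: tame_indicator.
move=> k mk.
have bc := bounded_measurable_cell s mk.
have bE j : bounded_measurable (\1_(E j) : T -> R).
  exact/bounded_measurable_indic/FT/FE.
have bEc j := bounded_measurableM (bE j) bc.
pose qN t := \sum_(j < N) M^-1 * (\1_(E j) t * \1_(cell k s) t).
have [bqN iqN] := bounded_measurable_sum lambda (index_enum 'I_N)
  (fun j : 'I_N => bounded_measurableM (bounded_measurable_cst T M^-1) (bEc j)).
have -> : \sum_(j < N) M^-1 * \int[lambda]_t (\1_(E j) t * \1_(cell k s) t) =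
    \int[lambda]_t qN t.
  rewrite /qN iqN; apply: eq_bigr => j _.
  by rewrite RintegralZl//; exact: bounded_measurable_integrable.
have bq : bounded_measurable q.
  split; first exact: F_measurableW.
  by exists B => t; have /andP[q0 qB'] := qB t; rewrite ger0_norm.
have close t : `|q t * \1_(cell k s) t - qN t| <= M^-1.
  have -> : qN t = M^-1 * (\sum_(j < N) \1_(E j) t) * \1_(cell k s) t.
    by rewrite /qN mulr_sumr mulr_suml; apply: eq_bigr => j _; rewrite mulrA.
  rewrite -mulrBl normrM.
  apply: (@le_trans _ _ (`|q t - M^-1 * (\sum_(j < N) \1_(E j) t)|)).
    by rewrite ler_piMr// indicE ger0_norm// lern1 leq_b1.
  have -> : q t - M^-1 * \sum_(j < N) \1_(E j) t =
      M^-1 * (M * q t - \sum_(j < N) (j.+1%:R <= M * q t)%R%:R).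
    rewrite mulrBr mulKf ?gt_eqF//; congr (_ - _ * _).
    by apply: eq_bigr => j _; rewrite indicE; congr (nat_of_bool _)%:R;
      apply/idP/idP; rewrite inE.
  rewrite normrM gtr0_norm ?invr_gt0// ler_piMr ?invr_ge0 ?(ltW M0)//.
  apply: layer_cake; have /andP[q0 qB'] := qB t.
  rewrite mulr_ge0 ?(ltW M0)//= (@le_trans _ _ (M * B))//.
    by rewrite ler_pM2l.
  by rewrite ltW// truncnS_gt.
have Mi0 : 0 <= M^-1 by rewrite invr_ge0 ltW.
have := integral_close lambda (bounded_measurableM bq bc) bqN Mi0
  measurableT close (fun t _ => close t).
rewrite setCT mass0 mulr0 addr0 [`|M^-1|]ger0_norm// => /le_trans; apply.
exact: ltW.
Qed.

Lemma tame_productB q s (B : R) : F_measurable q -> (forall t, `|q t| <= B) ->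
  tame (fun k => \int[lambda]_t (q t * \1_(cell k s) t)).
Proof.
move=> Fq qB.
have FqB : F_measurable (fun t => q t + B).
  move=> Y mY; have : measurable ((fun x => x + B) @^-1` Y).
    have mD : measurable_fun setT (fun x : R => x + B) by exact: measurable_funD.
    by rewrite -[X in measurable X]setTI; exact: mD.
  exact: Fq.
have tB : tame (fun k => \int[lambda]_t ((q t + B) * \1_(cell k s) t)).
  apply: (@tame_product _ _ (B + B)) => // t.
  by have := qB t; rewrite ler_norml => /andP[? ?]; apply/andP; split; lra.
have FT' : F setT by have [F0 /(_ _ F0)] := F_sigma; rewrite setD0.
apply: eq_tame (tameD tB (tameZ (- B) (tame_indicator s FT'))) => k mk.
have bc := bounded_measurable_cell s mk.
have bq : bounded_measurable q.
  by split; [exact: F_measurableW|exists B].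
have b1 := bounded_measurableM (bounded_measurable_indic R (FT FT')) bc.
have b2 : bounded_measurable (fun t => (q t + B) * \1_(cell k s) t).
  apply: bounded_measurableM => //; apply: bounded_measurableD => //.
  exact: bounded_measurable_cst.
rewrite -RintegralZl//; last exact: bounded_measurable_integrable.
rewrite -RintegralD//; first last.
- apply: bounded_measurable_integrable; apply: bounded_measurableM => //.
  exact: bounded_measurable_cst.
- exact: bounded_measurable_integrable.
by apply: eq_Rintegral => t _; rewrite indicT mul1r mulrDl mulNr addrK.
Qed.

End tame.

Section tame_caratheodory.
Context d (T : measurableType d) (R : realType) (lambda : probability T R).
Variables (F : set_system T) (A : pmetricType R) (pi : cantor_space -> A).
Hypotheses (F_sigma : sigma_algebra [set: T] F) (FT : F `<=` measurable).
Hypotheses (pi_cont : continuous pi) (pi_surj : forall a, exists x, pi x = a).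

Local Notation mass := (mass lambda).

Definition sample (j : nat) : A := pi (pad (odflt [::] (unpickle j))).

Lemma sample_pad s : exists j, sample j = pi (pad s).
Proof. by exists (pickle s); rewrite /sample pickleK. Qed.

Lemma pad_near (x : cantor_space) (W : set cantor_space) : nbhs x W ->
  exists n, forall m, (n <= m)%N -> W (pad (bits x m)).
Proof.
move=> /cantor_nbhsP[n nW]; exists n => m nm; apply: nW.
apply/bits_eqP => i ni; have /bits_eqP := bits_pad x m; apply.
exact: leq_trans nm.
Qed.

Lemma sample_dense (a : A) (e : R) : 0 < e -> exists j, (ball (sample j) e)° a.
Proof.
move=> e0; have [x <-] := pi_surj a; have e2 : 0 < e / 2 by rewrite divr_gt0.
have /pad_near[n /(_ n (leqnn _)) H] : nbhs x (pi @^-1` ball (pi x) (e / 2)).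
  by apply: pi_cont; exact: nbhsx_ballx.
have [j jE] := sample_pad (bits x n); exists j; rewrite jE.
apply: filterS (nbhsx_ballx (pi x) _ e2) => b xb.
by rewrite (splitr e); apply: ball_triangle xb; exact/ball_sym.
Qed.

Lemma F_measurableP q : measurable_fun [set: g_sigma_algebraType F] q ->
  F_measurable F (q : T -> R).
Proof.
move=> mq B mB; have := mq measurableT B mB.
by rewrite setTI sub_measurableE.
Qed.

Variable phi : T * A -> R.
Hypothesis phi_car : bounded_caratheodory F phi.

Lemma caratheodory_play k : strategy k ->
  bounded_measurable (fun t => phi (t, play pi k t)).
Proof.
have [mphi cphi [B phiB]] := phi_car.
move=> mk; split; last by exists B.
have mphi' (a : A) : measurable_fun [set: T] (fun t => phi (t, a)).
  by apply: (F_measurableW FT); exact: F_measurableP.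
have := joint_measurable sample_dense mphi' cphi.
move=> /measurableT_comp; apply.
apply/measurable_fun_pairP; split; first exact: measurable_id.
exact: measurable_play.
Qed.

(** Reading only the first [n] bits of [k t] changes [phi (t, pi (k t))] by at
    most [e'] whenever [t] lies in [G n], the set of agents for which the
    oscillation of [phi (t, pi _)] on every cylinder of depth [n] is at most
    [e']. By uniform continuity the sets [G n] increase to [T], so the rest has
    small mass for large [n]; and once [n] is fixed, the integral is a finite sum
    of integrals of [F]-measurable functions over cells. Testing the oscillation
    on the points [pad s] alone keeps [G n] a countable intersection. *)
Theorem tame_caratheodory :
  tame lambda F (fun k => \int[lambda]_t phi (t, play pi k t)).
Proof.
have [mphi cphi [B phiB]] := phi_car.
have B0 : 0 <= B by exact: le_trans (normr_ge0 _) (phiB point).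
apply: tame_lim => e e0.
have cphi_pi t : continuous (fun x => phi (t, pi x)).
  move=> x; apply: (@continuous_comp _ _ _ pi (fun a => phi (t, a)) x).
    exact: pi_cont.
  exact: cphi.
pose e' := e / (1 + 2 * B); have e'0 : 0 < e' by rewrite divr_gt0// ltr_pwDl// mulr_ge0.
pose same n (ss : seq bool * seq bool) := bits (pad ss.1) n = bits (pad ss.2) n.
pose osc ss := [set t | `|phi (t, pi (pad ss.1)) - phi (t, pi (pad ss.2))| <= e'].
pose G n := \bigcap_(ss in same n) osc ss.
have mosc ss : measurable (osc ss).
  have m a : measurable_fun [set: T] (fun t => phi (t, a)).
    by apply: (F_measurableW FT); exact: F_measurableP.
  rewrite -[X in measurable X]setTI.
  have mf : measurable_fun [set: T]
      (fun t => `|phi (t, pi (pad ss.1)) - phi (t, pi (pad ss.2))|).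
    by apply: measurableT_comp => //; exact: measurable_funB.
  rewrite (_ : osc ss = (fun t => `|phi (t, pi (pad ss.1)) -
      phi (t, pi (pad ss.2))|) @^-1` [set` `]-oo, e']]); first exact: mf.
  by apply/seteqP; split=> t; rewrite /osc /= in_itv.
have mG n : measurable (G n).
  rewrite -[G n]setCK setC_bigcap bigcup_mkcond; apply: measurableC.
  apply: countable_bigcupT_measurable; first exact: countableP.
  by move=> ss; case: ifP => // _; exact: measurableC.
have ndG : nondecreasing_seq G.
  apply/nondecreasing_seqP => n; apply/subsetPset => t Gt ss.
  by move=> [sn]; apply: Gt.
have UG : \bigcup_n G n = setT.
  apply/seteqP; split=> // t _.
  have [|n nP] := @cantor_modulus R (fun x => phi (t, pi x)) _ _ e'0.
    exact: cphi_pi.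
  by exists n => // ss /nP.
have modG n t x : G n t -> `|phi (t, pi x) - phi (t, pi (pad (bits x n)))| <= e'.
  move=> Gt; apply/ler_addgt0Pr => h h0.
  have /pad_near[m mP] : nbhs x [set y | `|phi (t, pi x) - phi (t, pi y)| < h].
    have /cvgrPdist_lt/(_ _ h0) : (fun y => phi (t, pi y)) @ x --> phi (t, pi x).
      exact: cphi_pi.
    by [].
  have /ltW Hx := mP _ (leq_maxl m n).
  have Hn := Gt (bits x (maxn m n), bits x n) _.
  rewrite (le_trans (ler_distD (phi (t, pi (pad (bits x (maxn m n))))) _ _))//.
  rewrite addrC lerD//; apply: Hn; rewrite /same /= bits_pad.
  apply/bits_eqP => i ni; have /bits_eqP := bits_pad x (maxn m n); apply.
  by rewrite (leq_trans ni)// leq_maxr.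
have : mass (G n) @[n --> \oo] --> mass (\bigcup_n G n) by exact: mass_bigcup.
rewrite UG massT => /cvgrPdist_lt/(_ _ e'0)[n _ /(_ n (leqnn _)) /= Gn].
have massGC : mass (~` G n) <= e'.
  have := mass_split lambda measurableT (mG n).
  by rewrite massT setTI setTD; move: Gn; rewrite ltr_norml => /andP[]; lra.
pose step k t := \sum_(s : n.-tuple bool) phi (t, pi (pad s)) * \1_(cell k s) t.
exists (fun k => \sum_(s : n.-tuple bool)
    \int[lambda]_t (phi (t, pi (pad s)) * \1_(cell k s) t)).
  apply: tame_sum => s; apply: (@tame_productB _ _ _ lambda _ F_sigma FT _ s B) => [|t].
    exact: F_measurableP.
  exact: phiB.
move=> k mk.
have bs (s : n.-tuple bool) :
    bounded_measurable (fun t => phi (t, pi (pad s)) * \1_(cell k s) t).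
  apply: bounded_measurableM; last exact: bounded_measurable_cell.
  split; last by exists B.
  by apply: (F_measurableW FT); exact: F_measurableP.
have [bstep <-] := bounded_measurable_sum lambda (index_enum _) bs.
have stepE t : step k t = phi (t, pi (pad (bits (k t) n))).
  have sz : size (bits (k t) n) == n by rewrite size_bits.
  rewrite /step (bigD1 (Tuple sz))//= big1 ?addr0 => [|s sE].
    by rewrite indicE mem_set ?mulr1// /cell /= size_bits.
  rewrite indicE memNset ?mulr0// /cell /= size_tuple => ks.
  by case/negP: sE; apply/eqP/val_inj.
have B2 : 0 <= 2 * B by rewrite mulr_ge0.
apply: (le_trans (integral_close lambda (caratheodory_play mk) bstep B2 (mG n) _
   (e := e') _)).
- move=> t; rewrite [X in _ - X]stepE (le_trans (ler_normB _ _))//.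
  by rewrite mulr_natl mulr2n lerD.
- by move=> t Gt; rewrite [X in _ - X]stepE; exact: modG.
rewrite gtr0_norm//.
apply: (@le_trans _ _ (e' + 2 * B * e')); first by rewrite lerD// ler_wpM2l.
by rewrite -[X in X + _]mul1r -mulrDl mulrC divfK// gt_eqF// ltr_pwDl.
Qed.

End tame_caratheodory.

(** * Convexity and compactness of the laws of pure strategies *)

Section strategies.
Context d (T : measurableType d) (R : realType) (lambda : probability T R).
Variables (F : set_system T).
Hypotheses (F_sigma : sigma_algebra [set: T] F) (FT : F `<=` measurable).

Local Notation mass := (mass lambda).

Definition strat := {k : T -> nat -> bool | strategy k}.

Definition weak_cvg (X : Type) (U : set_system X) (kappa : X -> strat) (k : strat) :=
  forall s E, F E ->
    mass (E `&` cell (sval (kappa x)) s) @[x --> U] --> mass (E `&` cell (sval k) s).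

Definition mixture n (p : 'I_n -> R) (kappa : 'I_n -> strat) (k : strat) :=
  forall s E, F E ->
    mass (E `&` cell (sval k) s) = \sum_i p i * mass (E `&` cell (sval (kappa i)) s).

Lemma tame_weak_cvg (X : Type) (U : set_system X) (kappa : X -> strat) k J :
  Filter U -> weak_cvg U kappa k -> tame lambda F J ->
  J (sval (kappa x)) @[x --> U] --> J (sval k).
Proof.
move=> FU kk tJ.
have span_cvg J' : cell_span lambda F J' ->
    J' (sval (kappa x)) @[x --> U] --> J' (sval k).
  elim=> [E s FE||J1 J2 _ c1 _ c2|c J1 _ c1]; first exact: kk.
  - exact: cvg_cst.
  - exact: cvgD.
  - exact: cvgMl_tmp.
apply/cvgrPdist_le => e e0; have e3 : 0 < e / 3 by rewrite divr_gt0.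
have [J' /span_cvg/cvgrPdist_le/(_ _ e3) cJ' JJ'] := tJ _ e3.
apply: filterS cJ' => x.
have := JJ' _ (svalP k); have := JJ' _ (svalP (kappa x)).
rewrite !ler_norml => /andP[? ?] /andP[? ?] /andP[? ?].
by apply/andP; split; lra.
Qed.

Lemma tame_mixture n (p : 'I_n -> R) (kappa : 'I_n -> strat) k J :
  (forall i, 0 <= p i) -> \sum_i p i = 1 -> mixture p kappa k ->
  tame lambda F J -> J (sval k) = \sum_i p i * J (sval (kappa i)).
Proof.
move=> p0 p1 kk tJ.
have span_mix J' : cell_span lambda F J' ->
    J' (sval k) = \sum_i p i * J' (sval (kappa i)).
  elim=> [E s FE||J1 J2 _ c1 _ c2|c J1 _ c1]; first exact: kk.
  - by rewrite big1// => i _; rewrite mulr0.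
  - by rewrite c1 c2 -big_split; apply: eq_bigr => i _; rewrite mulrDr.
  - by rewrite c1 mulr_sumr; apply: eq_bigr => i _; rewrite mulrCA.
apply/eqP; rewrite -subr_eq0 -normr_le0; apply/ler_addgt0Pr => e e0.
rewrite add0r (splitr e); have e2 : 0 < e / 2 by rewrite divr_gt0.
have [J' /span_mix mJ' JJ'] := tJ _ e2.
rewrite (le_trans (ler_distD (J' (sval k)) _ _))// lerD//.
  by apply: JJ'; exact: svalP.
rewrite mJ' -sumrB (le_trans (ler_norm_sum _ _ _))//.
apply: (@le_trans _ _ (\sum_i p i * (e / 2))); last first.
  by rewrite -mulr_suml p1 mul1r.
apply: ler_sum => i _.
rewrite -mulrBr normrM ger0_norm ?p0// ler_wpM2l// distrC.
by apply: JJ'; exact: svalP.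
Qed.

Hypothesis nowhere : nowhere_equivalent lambda F.

Let m_cell (k : strat) E s : F E -> measurable (E `&` cell (sval k) s).
Proof.
by move=> /FT mE; apply: measurableI => //; exact: measurable_cell (svalP k).
Qed.

Lemma cell_mass_add (k : strat) s :
  additive_on_F F (fun E => mass (E `&` cell (sval k) s)).
Proof.
move=> A B FA FB AB; rewrite setIUl massU//; try exact: m_cell.
by rewrite setIACA AB set0I.
Qed.

Lemma cell_mass_split (k : strat) s E : F E -> mass (E `&` cell (sval k) s) =
  mass (E `&` cell (sval k) (true :: s)) + mass (E `&` cell (sval k) (false :: s)).
Proof.
move=> FE; rewrite -massU; [|exact: m_cell|exact: m_cell|].
  congr mass; rewrite -setIUr; congr (_ `&` _).
  rewrite !cell_cons; apply/seteqP; split=> t /= => [ct|[[]|[]]//].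
  by case: (sval k t (size s)); [left|right].
by rewrite !cell_cons; apply/seteqP; split=> // t /= [[_ [_ ->]] [_ []]].
Qed.

Lemma cell_mass_itv (k : strat) s E : F E -> 0 <= mass (E `&` cell (sval k) s) <= 1.
Proof.
by move=> FE; rewrite mass_ge0 mass_le1//; exact: m_cell.
Qed.

(** The limits of the cell masses along [U] form a consistent family, which a
    pure strategy realizes. *)
Theorem strategies_compact (U : set_system strat) : UltraFilter U ->
  exists k, weak_cvg U id k.
Proof.
move=> UU.
have lim_ex sE : exists l : R, F sE.2 ->
    mass (sE.2 `&` cell (sval x) sE.1) @[x --> U] --> l.
  case: sE => s E /=; have [FE|nFE] := pselect (F E); last by exists 0.
  have [l _ lP] := ultra_cvg_itv UU (fun k => cell_mass_itv k s FE).
  by exists l.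
have /choice[L LP] := lim_ex.
have {}LP s E : F E -> mass (E `&` cell (sval x) s) @[x --> U] --> L (s, E).
  exact: LP (s, E).
have F_setU A B : F A -> F B -> F (A `|` B).
  by rewrite -(sub_measurableE F_sigma); exact: measurableU.
have [|s E FE|E FE|s E FE|k mk kL] := realization F_sigma FT nowhere
    (L := fun s E => L (s, E)).
- move=> s A B FA FB AB; apply: (cvg_unique _ (LP s _ (F_setU _ _ FA FB))) => //.
  rewrite (_ : (fun k : strat => _) = (fun k => mass (A `&` cell (sval k) s) +
      mass (B `&` cell (sval k) s))).
    by apply: cvgD; exact: LP.
  by apply/funext => k; exact: (cell_mass_add _ _ FA FB AB).
- apply: (cvgr_to_ge (LP s E FE)); apply: nearW => k; exact: mass_ge0.
- apply: (cvg_unique _ (LP [::] E FE)) => //.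
  rewrite (_ : (fun k : strat => _) = cst (mass E)); first exact: cvg_cst.
  by apply/funext => k; rewrite cell_nil setIT.
- apply: (cvg_unique _ (LP s E FE)) => //.
  rewrite (_ : (fun k : strat => _) = (fun k => mass (E `&` cell (sval k) (true :: s)) +
      mass (E `&` cell (sval k) (false :: s)))).
    by apply: cvgD; exact: LP.
  by apply/funext => k; exact: cell_mass_split.
exists (exist _ k mk) => s E FE /=.
by rewrite kL//; exact: LP.
Qed.

Theorem mixture_exists n (p : 'I_n -> R) (kappa : 'I_n -> strat) :
  (forall i, 0 <= p i) -> \sum_i p i = 1 -> exists k, mixture p kappa k.
Proof.
move=> p0 p1.
have [s A B FA FB AB|s E FE|E FE|s E FE|k mk kL] := realization F_sigma FT nowhere
    (L := fun s E => \sum_i p i * mass (E `&` cell (sval (kappa i)) s)).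
- rewrite -big_split; apply: eq_bigr => i _ /=.
  by rewrite -mulrDr -(cell_mass_add _ _ FA FB AB).
- by apply: sumr_ge0 => i _; rewrite mulr_ge0// mass_ge0.
- under eq_bigr do rewrite cell_nil setIT.
  by rewrite -mulr_suml p1 mul1r.
- rewrite -big_split; apply: eq_bigr => i _ /=.
  by rewrite -mulrDr -(cell_mass_split _ _ FE).
by exists (exist _ k mk).
Qed.

End strategies.

Lemma cvg_initial (S : choiceType) (X : topologicalType) (f : S -> X)
    (G : set_system S) (s : S) : Filter G ->
  f @ G --> f s -> G --> (s : initial_topology f).
Proof.
move=> FG fGs W; rewrite nbhsE => -[_ [[V oV <-] Vs] VW].
apply: filterS VW _; apply: fGs; exact: open_nbhs_nbhs.
Qed.

Section laws.
Context d (T : measurableType d) (R : realType) (lambda : probability T R).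
Variables (F : set_system T) (A : pmetricType R) (pi : cantor_space -> A).
Hypotheses (F_sigma : sigma_algebra [set: T] F) (FT : F `<=` measurable).
Hypotheses (pi_cont : continuous pi) (pi_surj : forall a, exists x, pi x = a).

Definition play_mfun (k : strat T) : {mfun T >-> borel A} :=
  HB.pack (play pi (sval k) : T -> borel A)
    (isMeasurableFun.Build _ _ _ _ _ (measurable_play pi_cont (svalP k))).

Definition law (k : strat T) : distributions F A :=
  joint_distribution lambda FT (play_mfun k).

Lemma integral_law k phi : bounded_caratheodory F phi ->
  \int[law k : product_law F A]_x phi x = \int[lambda]_t phi (t, play pi (sval k) t).
Proof.
move=> phi_car; have [mphi cphi [B phiB]] := phi_car.
have mphi2 := joint_measurable (sample_dense pi_cont pi_surj) mphi cphi.
rewrite /Rintegral /law /joint_distribution; congr fine.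
have int_phi : lambda.-integrable (graph (F := F) (play_mfun k) FT @^-1` setT)
    ((EFin \o phi) \o graph (play_mfun k) FT).
  exact: (bounded_measurable_integrable lambda
    (caratheodory_play F_sigma FT pi_cont pi_surj phi_car (svalP k))).
exact: (integral_pushforward (measurable_graph FT (play_mfun k))
  (f := EFin \o phi) (iffRL (measurable_EFinP _ _) mphi2) int_phi measurableT).
Qed.

Lemma law_cvg (X : Type) (U : set_system X) (kappa : X -> strat T) k :
  Filter U -> weak_cvg lambda F U kappa k ->
  law (kappa x) @[x --> U] --> law k.
Proof.
move=> FU kk; apply/cvg_sup => -[phi phi_car].
apply: (@cvg_initial _ _ (fun rho : product_law F A => \int[rho]_x phi x)).
have := tame_weak_cvg FU kk (tame_caratheodory lambda F_sigma FT pi_cont pi_surj phi_car).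
rewrite -(integral_law k phi_car).
rewrite (_ : (fun x => _) = (fun x => \int[law (kappa x) : product_law F A]_y phi y)) //.
by apply/funext => x; rewrite integral_law.
Qed.

End laws.

(** * Continuity of payoffs in the law *)

Section evaluation.
Context (X : topologicalType) (R : realType).
Implicit Types u : Cb X R.

Lemma eval_le_norm u x : `|u x| <= `|u|.
Proof. exact: sup_norm_ub. Qed.

Lemma eval_continuous x : continuous (fun u => u x).
Proof.
move=> u; apply/(@cvgrPdist_le _ _ _ _ (nbhs_filter u)) => e e0; near=> w.
have -> : u x - w x = (u - w) x by [].
apply: le_trans (eval_le_norm _ _) _; near: w.
exact: cvgr_dist_le.
Unshelve. all: by end_near. Qed.

(** Dividing by one plus the norm makes all payoffs bounded by one and thus
    integrable, without changing the preferences of any agent. *)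
Definition normalize u x : R := u x / (1 + `|u|).

Lemma norm_den_gt0 u : 0 < 1 + `|u|.
Proof. by rewrite ltr_pwDl. Qed.

Lemma normalize_continuous x : continuous (fun u => normalize u x).
Proof.
move=> u; have Fu := nbhs_filter u.
apply: (@cvgM _ _ (nbhs u) Fu); first exact: eval_continuous.
apply: (@cvgV _ _ (nbhs u) Fu); first by rewrite gt_eqF// norm_den_gt0.
by apply: (@cvgD _ _ _ (nbhs u) Fu); [exact: cvg_cst|exact: norm_continuous].
Qed.

Lemma normalize_le1 u x : `|normalize u x| <= 1.
Proof.
rewrite normrM normfV (gtr0_norm (norm_den_gt0 u)) ler_pdivrMr ?norm_den_gt0//.
by rewrite mul1r (le_trans (eval_le_norm _ _))// lerDr.
Qed.

Lemma normalize_le u x y : (normalize u x <= normalize u y) = (u x <= u y).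
Proof. by rewrite ler_pM2r// invr_gt0 norm_den_gt0. Qed.

Lemma normalize_dist u x y : `|normalize u x - normalize u y| <= `|u x - u y|.
Proof.
rewrite -mulrBl normrM normfV (gtr0_norm (norm_den_gt0 u)).
by rewrite ler_piMr// invf_le1 ?norm_den_gt0// lerDl.
Qed.

End evaluation.

Section tube.
Context (A X : topologicalType) (R : realType).
Hypothesis A_compact : compact [set: A].

(** The tube lemma, with [A] as the compact factor. *)
Lemma compact_uniform_near (u : A * X -> R) x0 e : continuous u -> 0 < e ->
  \forall x \near x0, forall a, `|u (a, x) - u (a, x0)| <= e.
Proof.
move=> cu e0; have e2 : 0 < e / 2 by rewrite divr_gt0.
have /compact_near_coveringP cov := A_compact.
have H : \forall x \near x0, [set: A] `<=` (fun a => `|u (a, x) - u (a, x0)| <= e).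
  apply: cov => a _.
  have /cvgrPdist_lt/(_ _ e2) ua := cu (a, x0).
  have ua0 : \forall a' \near a & x \near x0, `|u (a, x0) - u (a', x0)| < e / 2.
    move: ua => [[P Q] /= [aP x0Q] PQ].
    exists (P, setT); first by split => //; exact: filterT.
    move=> [a' x] [/= Pa' _]; apply: (PQ (a', x0)); split=> //=.
    exact: nbhs_singleton.
  have ua1 : \forall a' \near a & x \near x0, `|u (a, x0) - u (a', x)| < e / 2.
    by move: ua => [[P Q] /= PQ1 PQ]; exists (P, Q) => // -[a' x]; exact: PQ.
  apply: filterS2 ua0 ua1 => -[a' x] /=.
  by rewrite !ltr_norml ler_norml => /andP[? ?] /andP[? ?]; apply/andP; split; lra.
by apply: filterS H => x H a; exact: H.
Qed.

End tube.

Section payoffs.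
Context d (T : measurableType d) (R : realType) (lambda : probability T R).
Variables (F : set_system T) (A : pmetricType R) (pi : cantor_space -> A).
Hypotheses (F_sigma : sigma_algebra [set: T] F) (FT : F `<=` measurable).
Hypotheses (pi_cont : continuous pi) (pi_surj : forall a, exists x, pi x = a).
Hypothesis A_compact : compact [set: A].
Variable v : T -> payoff_space F A.
Hypothesis v_game : game_function lambda v.

Local Notation mass := (mass lambda).

Lemma F_preimage_open (W : set (payoff_space F A)) : open W -> F (v @^-1` W).
Proof.
move=> oW; have [mv _] := v_game.
have mW : measurable (W : set (borel (payoff_space F A))).
  exact: sub_sigma_algebra.
have := mv measurableT W mW.
by rewrite setTI sub_measurableE.
Qed.

Lemma F_measurable_comp (theta : payoff_space F A -> R) : continuous theta ->
  measurable_fun [set: g_sigma_algebraType F] (fun t => theta (v t)).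
Proof.
move=> /continuousP ctheta.
apply: (measurability _ (RGenOpens.measurableE R)).
move=> _ [_ [a [b ->]] <-]; rewrite setTI sub_measurableE//.
have oI : open (`]a, b[%classic : set R) by exact: interval_open.
exact: F_preimage_open (ctheta _ oI).
Qed.

Definition payoff (rho : distributions F A) (ta : T * A) : R :=
  normalize (v ta.1) (ta.2, rho).

Lemma payoff_caratheodory rho : bounded_caratheodory F (payoff rho).
Proof.
split.
- move=> a; have cn : continuous (fun u : payoff_space F A => normalize u (a, rho)).
    exact: normalize_continuous.
  by have := F_measurable_comp cn.
- move=> t a; apply: (@cvgM _ _ (nbhs a) (nbhs_filter a)
    (fun a => v t (a, rho)) (fun=> (1 + `|v t|)^-1)); last exact: cvg_cst.
  apply: (@continuous_comp _ _ _ (fun a => (a, rho)) (v t) a).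
    move=> W [[P Q] /= [aP rhoQ] PQ]; apply: filterS aP => a' Pa'.
    by apply: (PQ (a', rho)); split=> //=; exact: nbhs_singleton rhoQ.
  exact: Cb_continuous.
- by exists 1 => ta; exact: normalize_le1.
Qed.

Definition utility (rho : distributions F A) (k : T -> nat -> bool) : R :=
  \int[lambda]_t payoff rho (t, play pi k t).

(** Strong measurability puts almost every [v t] in the closure of a countable
    set, so balls of radius [e] around finitely many of its points catch [v t]
    for all [t] outside a set of mass at most [e]. *)
Lemma essentially_separable (e : R) : 0 < e ->
  exists (u_ : nat -> payoff_space F A) (N : nat) (G : set T),
  [/\ F G, mass (~` G) <= e &
    forall t, G t -> exists2 j, (j < N)%N & `|v t - u_ j| < e].
Proof.
move=> e0; have [mv [s ms sv]] := v_game.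
pose Q := \bigcup_n range (s n).
have cQ : countable Q by apply: bigcup_countable => // n _; exact: (ms n).2.
have [f finj] := countable_injP _ cQ.
pose u_ j := xget 0 [set q | Q q /\ f q = j].
have u_f q : Q q -> u_ (f q) = q.
  move=> Qq; have [Qu fu] : Q (u_ (f q)) /\ f (u_ (f q)) = f q.
    by apply: (@xgetPex _ 0 [set q' | Q q' /\ f q' = f q]); exists q.
  by apply: finj => //; rewrite inE.
pose G N := \bigcup_(j in `I_N) (v @^-1` [set w | `|w - u_ j| < e]).
have FG N : F (G N).
  rewrite -(sub_measurableE F_sigma); apply: bigcup_measurable => j _.
  rewrite sub_measurableE//; apply: F_preimage_open.
  rewrite (_ : mkset _ = ball (u_ j) e); first exact: ball_open.
  by apply/seteqP; split=> w; rewrite -ball_normE /= distrC.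
have mG N := FT (FG N).
have ndG : nondecreasing_seq G.
  apply/nondecreasing_seqP => n; apply/subsetPset => t [j jn vj].
  by exists j => //; exact: ltnW.
have UG : mass (~` \bigcup_N G N) = 0.
  rewrite /mass measure_negligible//.
    by apply: measurableC; exact: bigcup_measurable.
  apply: negligibleS sv => t nG sv; apply: nG.
  have /cvgrPdist_lt/(_ _ e0)[n _ /(_ n (leqnn _)) vn] := sv.
  exists (f (s n t)).+1 => //; exists (f (s n t)) => //=.
  by rewrite u_f//; exists n.
have : mass (G N) @[N --> \oo] --> mass (\bigcup_N G N) by exact: mass_bigcup.
have mUG : measurable (\bigcup_N G N) by exact: bigcup_measurable.
have -> : mass (\bigcup_N G N) = 1.
  have := mass_split lambda measurableT mUG.
  by rewrite massT setTI setTD UG addr0.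
move=> /cvgrPdist_lt/(_ _ e0)[N _ /(_ N (leqnn _)) /= GN].
exists u_, N, (G N); split => //.
  have := mass_split lambda measurableT (mG N).
  by rewrite massT setTI setTD; move: GN; rewrite ltr_norml => /andP[]; lra.
Qed.

(** For the finitely many payoffs [u_ j] near which almost all agents lie, the
    tube lemma gives a common neighbourhood of [rho0]. There, an agent close to
    one of them errs by at most [3 * h], and the others, of mass [h], by at most
    [2]. *)
Lemma utility_continuous rho0 e : 0 < e -> \forall rho \near rho0,
  forall k, strategy k -> `|utility rho k - utility rho0 k| <= e.
Proof.
move=> e0; pose h := e / 5; have h0 : 0 < h by rewrite divr_gt0.
have [u_ [N [G [FG Gh GP]]]] := essentially_separable h0.
have uj : \forall rho \near rho0, forall j : 'I_N, forall a,
    `|u_ j (a, rho) - u_ j (a, rho0)| <= h.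
  apply: (@filter_forall _ 'I_N (fun j => [set rho | forall a,
    `|u_ j (a, rho) - u_ j (a, rho0)| <= h]) (nbhs rho0) (nbhs_filter rho0)) => j.
  exact: (compact_uniform_near A_compact rho0 (@Cb_continuous _ _ (u_ j)) h0).
apply: filterS uj => rho uj k mk.
have bm r := caratheodory_play F_sigma FT pi_cont pi_surj (payoff_caratheodory r) mk.
apply: le_trans (integral_close lambda (bm rho) (bm rho0) (ler0n R 2) (FT FG)
  (e := 3 * h) _ _) _.
- move=> t; rewrite (le_trans (ler_normB _ _))//.
  by rewrite (_ : 2%:R = 1 + 1 :> R)// lerD// normalize_le1.
- move=> t /GP[j jN vj]; apply: le_trans (normalize_dist _ _ _) _.
  have := uj (Ordinal jN) (play pi k t) => /=.
  have := le_lt_trans (eval_le_norm (v t - u_ j) (play pi k t, rho)) vj.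
  have := le_lt_trans (eval_le_norm (v t - u_ j) (play pi k t, rho0)) vj.
  have sub_eval (w w' : payoff_space F A) x : (w - w') x = w x - w' x by [].
  rewrite !sub_eval /= !ltr_norml !ler_norml.
  move=> /andP[? ?] /andP[? ?] /andP[? ?]; apply/andP; split; lra.
rewrite gtr0_norm ?mulr_gt0//.
by rewrite /h; rewrite /h in Gh; lra.
Qed.

End payoffs.

(** * Existence of an equilibrium *)

Section equilibrium.
Context d (T : measurableType d) (R : realType) (lambda : probability T R).
Variables (F : set_system T) (A : pmetricType R) (pi : cantor_space -> A).
Hypotheses (F_sigma : sigma_algebra [set: T] F) (FT : F `<=` measurable).
Hypotheses (pi_cont : continuous pi) (pi_surj : forall a, exists x, pi x = a).
Hypothesis A_compact : compact [set: A].
Hypothesis nowhere : nowhere_equivalent lambda F.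
Variable v : T -> payoff_space F A.
Hypothesis v_game : game_function lambda v.

Local Notation law := (law lambda FT pi_cont).
Local Notation utility := (utility lambda pi v).
Local Notation mass := (mass lambda).

Lemma tame_utility rho : tame lambda F (utility rho).
Proof.
exact: (tame_caratheodory lambda F_sigma FT pi_cont pi_surj
  (payoff_caratheodory F_sigma v_game rho)).
Qed.

Lemma utility_law_cvg (X : Type) (U : set_system X) (kappa : X -> strat T) k e :
  Filter U -> weak_cvg lambda F U kappa k -> 0 < e -> \forall x \near U,
    forall g : strat T,
    `|utility (law (kappa x)) (sval g) - utility (law k) (sval g)| <= e.
Proof.
move=> FU kk e0.
have lc := law_cvg (FT := FT) (pi_cont := pi_cont) F_sigma pi_surj FU kk.
have near_law := lc _ (utility_continuous F_sigma FT pi_cont pi_surj A_compact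
  v_game (law k) e0).
apply: (@filterS _ U FU _ _ _ near_law) => x H g; apply: H; exact: svalP.
Qed.

(** The mixtures of the [kappa i] are parametrized by the simplex; linearity of
    [tame_mixture] turns an equilibrium of the simplex into a mixture whose own
    payoff is the largest. *)
Lemma finite_best_reply n (kappa : 'I_n.+1 -> strat T) : exists k : strat T,
  forall i, utility (law k) (sval (kappa i)) <= utility (law k) (sval k).
Proof.
have /choice[mix mixP] : forall p : 'I_n.+1 -> R, exists k,
    simplex p -> mixture lambda F p kappa k.
  move=> p; have [[p0 p1]|np] := pselect (simplex p); last first.
    by exists (kappa ord0).
  by have [k kP] := mixture_exists F_sigma FT nowhere kappa p0 p1; exists k.
have [|p sp pP] := @simplex_equilibrium R n
    (fun i p => utility (law (mix p)) (sval (kappa i))).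
  move=> i p sp e e0.
  pose near_p (r : R) := [set q : 'I_n.+1 -> R | simplex q /\ forall j, `|q j - p j| < r].
  pose G := filter_from [set r | 0 < r] near_p.
  have GF : Filter G.
    apply: filter_from_filter; first by exists 1 => /=.
    move=> r s /= r0 s0; exists (Num.min r s); first by rewrite /= lt_min r0.
    by move=> q [sq qp]; split; split=> // j; have := qp j; rewrite lt_min => /andP[].
  have coord j : q j @[q --> G] --> p j.
    apply/cvgrPdist_lt => r r0; exists r => // q [_ /(_ j)].
    by rewrite distrC.
  have kk : weak_cvg lambda F G mix (mix p).
    move=> s E FE; rewrite (mixP p sp)//.
    have : (fun q : 'I_n.+1 -> R => \sum_j q j * mass (E `&` cell (sval (kappa j)) s))
        @ G --> \sum_j p j * mass (E `&` cell (sval (kappa j)) s).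
      by apply: cvgr_sum => j; apply: cvgMr_tmp; exact: coord.
    apply: cvg_trans; apply: near_eq_cvg; exists 1 => //= q [sq _].
    by rewrite (mixP q sq).
  have [r r0 rP] := utility_law_cvg GF kk e0.
  by exists r => // q sq qp; apply: rP; split.
exists (mix p) => i; apply: le_trans (pP i) _.
have [p0 p1] := sp.
by rewrite -(tame_mixture p0 p1 (mixP p sp) (tame_utility _)).
Qed.

(** At the limit [k] of the ultrafilter, both sides of each inequality are
    controlled: the law of [x] tends to that of [k], uniformly in the strategy
    played against it, and playing [x] against the fixed law of [k] is a tame
    functional of [x]. *)
Theorem pure_equilibrium_integral : exists k : strat T,
  forall g : strat T, utility (law k) (sval g) <= utility (law k) (sval k).
Proof.
pose better (g k : strat T) := utility (law k) (sval g) <= utility (law k) (sval k).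
pose base (l : seq (strat T)) := [set k | all (better^~ k) l].
pose B := filter_from [set: seq (strat T)] base.
(* the constant strategy only makes the list of deviations nonempty *)
have k0 : strat T.
  exists (fun _ _ => false) => n; rewrite (_ : mkset _ = set0) //.
  by apply/seteqP; split=> t /=.
have BF : ProperFilter B.
  apply: filter_from_proper; last first.
    move=> l _; have [k kP] :=
      finite_best_reply (fun i : 'I_(size l).+1 => nth k0 (k0 :: l) i).
    exists k; apply/(all_nthP k0) => i il.
    by have := kP (lift ord0 (Ordinal il)).
  apply: filter_from_filter; first by exists [::].
  move=> l1 l2 _ _; exists (l1 ++ l2) => // k; rewrite /base /= all_cat.
  by move=> /andP[].
have [U [UU BU]] := ultraFilterLemma BF.
have [k kk] := strategies_compact F_sigma FT nowhere UU.
exists k => g; apply/ler_addgt0Pr => e e0.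
have e3 : 0 < e / 3 by rewrite divr_gt0.
have Ug : U [set x | better g x].
  by apply: BU; exists [:: g] => // x; rewrite /base /= andbT.
have UF : Filter U by typeclasses eauto.
have Uu := utility_law_cvg UF kk e3.
have /cvgrPdist_le/(_ _ e3) Uk := tame_weak_cvg UF kk (tame_utility (law k)).
have [x [[gx ux] kx]] := filter_ex (filterI (filterI Ug Uu) Uk).
move: gx kx (ux g) (ux x); rewrite /better /= !ler_norml.
by move=> ? /andP[? ?] /andP[? ?] /andP[? ?]; lra.
Qed.

Lemma strategy_cst (x : nat -> bool) : strategy (fun _ : T => x).
Proof.
move=> n; rewrite /mkset; case: (x n).
  have -> : (fun _ : T => true : Prop) = setT by apply/seteqP.
  exact: measurableT.
have -> : (fun _ : T => false : Prop) = set0 by apply/seteqP; split.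
exact: measurable0.
Qed.

Lemma deviate_strategy (k : strat T) (D : set T) (x : nat -> bool) :
  measurable D -> strategy (fun t => if `[< D t >] then x else sval k t).
Proof.
move=> mD n.
rewrite (_ : mkset _ =
    (D `&` [set _ | x n]) `|` (~` D `&` [set t | sval k t n])).
  have m1 : measurable (D `&` [set _ | x n]).
    by apply: measurableI => //; exact: strategy_cst.
  have m2 : measurable (~` D `&` [set t | sval k t n]).
    by apply: measurableI; [exact: measurableC|exact: (svalP k)].
  exact: measurableU.
apply/seteqP; split=> t /=.
  by case: asboolP => Dt kt; [left|right].
by case: asboolP => Dt -[[]|[]].
Qed.

Lemma payoff_play rho (k : strat T) :
  bounded_measurable (fun t => payoff v rho (t, play pi (sval k) t)).
Proof.
exact: (caratheodory_play F_sigma FT pi_cont pi_surj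
  (payoff_caratheodory F_sigma v_game rho) (svalP k)).
Qed.

(** Playing [x] exactly where it pays raises the payoff of every agent in that
    set and of no other. Since the integrated payoff cannot rise, the gain
    vanishes almost everywhere. *)
Lemma no_profitable_deviation rho (k : strat T) (x : cantor_space) :
  (forall g : strat T, utility rho (sval g) <= utility rho (sval k)) ->
  lambda.-negligible [set t |
    payoff v rho (t, play pi (sval k) t) < payoff v rho (t, pi x)].
Proof.
move=> k_opt; set D := mkset _.
pose h (g : strat T) t := payoff v rho (t, play pi (sval g) t).
pose kx : strat T := exist _ _ (strategy_cst x).
have mD : measurable D.
  have := measurable_fun_ltr (payoff_play rho k).1 (payoff_play rho kx).1.
  move=> /(_ measurableT [set true]); rewrite setTI; apply.
  exact: I.
pose g : strat T := exist _ _ (deviate_strategy k x mD).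
have hg t : h g t = if `[< D t >] then payoff v rho (t, pi x) else h k t.
  by rewrite /h /play /=; case: asboolP.
pose gain t := h g t - h k t.
have gain_ge0 t : 0 <= gain t.
  rewrite /gain hg; case: asboolP => [|_]; last by rewrite subrr.
  by rewrite /D /= => /ltW; rewrite subr_ge0.
have bgain : bounded_measurable gain.
  by apply: bounded_measurableB; exact: payoff_play.
have int_gain : \int[lambda]_t gain t = 0.
  apply/eqP; rewrite eq_le Rintegral_ge0// andbT.
  rewrite RintegralB//; try by [exact/bounded_measurable_integrable/payoff_play].
  by rewrite subr_le0; exact: k_opt g.
have := ae_eq_integral_abs lambda measurableT (f := EFin \o gain).
case; first by apply/measurable_EFinP; exact: bgain.1.
move=> /(_ _) ae_gain _.
have {}ae_gain : ae_eq lambda setT (EFin \o gain) (cst 0%E).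
  apply: ae_gain; rewrite -[RHS]/(0%:E) -[in RHS]int_gain /Rintegral fineK.
    by apply: eq_integral => t _; rewrite /= ger0_norm.
  apply: integrable_fin_num => //; exact: bounded_measurable_integrable.
apply: negligibleS ae_gain => t Dt /= /(_ I) [].
rewrite /gain hg asboolT// => /eqP; rewrite subr_eq0 => /eqP e.
by move: Dt; rewrite /D /= e ltxx.
Qed.

(** Countably many actions are dense in [A], so the exceptional null sets add up
    to a null set, and continuity covers the remaining actions. *)
Theorem pure_equilibrium : exists k : strat T,
  {ae lambda, forall t, forall a : A,
    v t (a, law k) <= v t (play pi (sval k) t, law k)}.
Proof.
have [k k_opt] := pure_equilibrium_integral; exists k.
pose bad j := [set t | payoff v (law k) (t, play pi (sval k) t) <
                       payoff v (law k) (t, sample pi j)].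
have neg : lambda.-negligible (\bigcup_j bad j).
  by apply: negligible_bigcup => j; exact: no_profitable_deviation.
apply: negligibleS neg => t /=; apply: contra_notP => good a.
rewrite -normalize_le; have [x <-] := pi_surj a.
have [_ cpay _] := payoff_caratheodory F_sigma v_game (law k).
have cpi : continuous (fun x => payoff v (law k) (t, pi x)).
  move=> y; apply: (@continuous_comp _ _ _ pi (fun a => payoff v (law k) (t, a)) y).
    exact: pi_cont.
  exact: cpay.
apply/ler_addgt0Pr => e e0.
have /cvgrPdist_lt/(_ _ e0)/pad_near[n /(_ n (leqnn _)) /=] := cpi x.
have [j jE] := sample_pad pi (bits x n).
have : payoff v (law k) (t, sample pi j) <= payoff v (law k) (t, play pi (sval k) t).
  by rewrite leNgt; apply/negP => bj; apply: good; exists j.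
by rewrite jE /payoff /= ltr_norml => ? /andP[? ?]; lra.
Qed.

End equilibrium.


Theorem corollary7 (R : realType) (d : measure_display) (T : measurableType d)
    (lambda : probability T R) (F : set_system T) (A : pmetricType R)
    (lambda_complete : measure_is_complete lambda)
    (lambda_atomless : atomless lambda)
    (F_sigma : sigma_algebra [set: T] F)
    (FT : F `<=` measurable)
    (A_compact : compact [set: A])
    (T_nowhere_F : nowhere_equivalent lambda F)
    (v : T -> payoff_space F A)
    (v_game : game_function lambda v) :
  exists f : {mfun T >-> borel A},
    {ae lambda, forall t, forall a : A,
      v t (f t, joint_distribution lambda FT f)
        >= v t (a, joint_distribution lambda FT f)}.
Proof.
have A_hausdorff : hausdorff_space A by exact: metric_hausdorff.
have [pi pi_cont] := cantor_surj A_compact A_hausdorff.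
have pi_surj a : exists x, pi x = a.
  by have [x _ xa] := @surj _ _ _ _ pi a I; exists x.
have [k k_eq] :=
  pure_equilibrium F_sigma FT pi_cont pi_surj A_compact T_nowhere_F v_game.
by exists (play_mfun pi_cont k).
Qed.
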